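(* Let $K$ be an algebraically closed field of characteristic $p\ge 0$ and let $f\in K[[x,y]]$ be reduced. Then $$\gamma(f)\;\leq\;\tilde\gamma(f)\;\leq\;\kappa(f)-\mathrm{mt}(f)+1,$$ and both inequalities are equalities if $p$ is multiplicity good (m-good) for $f$.
   Context: For $f,g\in K[[x,y]]$, $i(f,g):=\dim_K K[[x,y]]/\langle f,g\rangle\in\mathbb{N}\cup\{\infty\}$; $f_x,f_y$ are the partial derivatives. $f$ is reduced if it is nonzero and has no multiple irreducible factor. The kappa invariant is $\kappa(f):=i(f,\alpha f_x+\beta f_y)$ for generic $(\alpha:\beta)\in\mathbb{P}^1$. The multiplicity $\mathrm{mt}(f)$ is the largest $k$ with $f\in\langle x,y\rangle^k$. The number $\tilde\gamma(f)=\tilde\gamma_{x,y}(f)$ of a reduced $f$ (with respect to the fixed coordinates $x,y$) is defined by: (1) $\tilde\gamma(x):=0$, $\tilde\gamma(y):=0$; (2) if $f$ is irreducible and convenient (i.e. $i(f,x),i(f,y)<\infty$), then $\tilde\gamma(f):=\min\{i(f,f_x)-i(f,y)+1,\ i(f,f_y)-i(f,x)+1\}$; (3) if $f=f_1\cdots f_r$ with $f_i$ irreducible, then $\tilde\gamma(f):=\sum_{i=1}^r\big(\tilde\gamma(f_i)+\sum_{j\ne i}i(f_i,f_j)\big)-r+1$. One has $\tilde\gamma(u)=1$ and $\tilde\gamma(u f)=\tilde\gamma(f)$ for every unit $u$ (in particular $\tilde\gamma(ux)=\tilde\gamma(uy)=0$). The gamma invariant $\gamma(f)$ is the minimum of $\tilde\gamma_{X,Y}(f)$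 over all coordinate systems $X,Y$ of $K[[x,y]]$, i.e. the minimum of $\tilde\gamma(g)$ over all $g$ right equivalent to $f$, where $f,g$ are right equivalent if $f=\Phi(g)$ for some $K$-algebra automorphism $\Phi$ of $K[[x,y]]$. With $f=f_1\cdots f_r$, $f_i$ irreducible, $p$ is multiplicity good (m-good) for $f$ if $\mathrm{mt}(f_i)\neq 0\pmod p$ for all $i$ (for $p=0$ this always holds). *)

(* Defs.v *)
From HB Require Import structures.
From mathcomp Require Import all_boot all_order all_algebra.
From mathcomp Require Import boolp classical_sets constructive_ereal.

Set Implicit Arguments.
Unset Strict Implicit.
Unset Printing Implicit Defensive.

Import Order.TTheory GRing.Theory Num.Theory.
Local Open Scope ring_scope.

(* K[[x,y]]: [coef2 f i j] is the coefficient of x^i y^j. *)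
Record fps2 (K : Type) := Fps2 { coef2 : nat -> nat -> K }.

HB.instance Definition _ (K : Type) := gen_eqMixin (fps2 K).
HB.instance Definition _ (K : Type) := gen_choiceMixin (fps2 K).

Lemma fps2P (K : Type) (f g : fps2 K) :
  (forall i j, coef2 f i j = coef2 g i j) -> f = g.
Proof.
case: f g => [f] [g] /= fg; congr Fps2.
by apply: funext => i; apply: funext => j.
Qed.

Section Fps2Ring.
Variable K : comNzRingType.
Implicit Types f g h : fps2 K.

Definition fps2_zero : fps2 K := Fps2 (fun _ _ => 0).
Definition fps2_opp f := Fps2 (fun i j => - coef2 f i j).
Definition fps2_add f g := Fps2 (fun i j => coef2 f i j + coef2 g i j).
Definition fps2_scale (c : K) f := Fps2 (fun i j => c * coef2 f i j).
Definition fps2_one : fps2 K := Fps2 (fun i j => ((i == 0%N) && (j == 0%N))%:R).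
Definition fps2_mul f g := Fps2 (fun i j =>
  \sum_(a < i.+1) \sum_(b < j.+1) coef2 f a b * coef2 g (i - a)%N (j - b)%N).

Lemma fps2_addA : associative fps2_add.
Proof. by move=> f g h; apply: fps2P => i j /=; rewrite addrA. Qed.
Lemma fps2_addC : commutative fps2_add.
Proof. by move=> f g; apply: fps2P => i j /=; rewrite addrC. Qed.
Lemma fps2_add0 : left_id fps2_zero fps2_add.
Proof. by move=> f; apply: fps2P => i j /=; rewrite add0r. Qed.
Lemma fps2_addN : left_inverse fps2_zero fps2_opp fps2_add.
Proof. by move=> f; apply: fps2P => i j /=; rewrite addNr. Qed.

HB.instance Definition _ := GRing.isZmodule.Build (fps2 K)
  fps2_addA fps2_addC fps2_add0 fps2_addN.

(* Truncation to K[x][y], used only to transfer the ring axioms. *)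
Let trunc n f : {poly {poly K}} := \poly_(i < n) \poly_(j < n) coef2 f i j.

Let trunc_coef n f i j : (i < n)%N -> (j < n)%N -> (trunc n f)`_i`_j = coef2 f i j.
Proof. by move=> ltin ltjn; rewrite coef_poly ltin coef_poly ltjn. Qed.

Let coefM2 (P Q : {poly {poly K}}) i j : (P * Q)`_i`_j =
  \sum_(a < i.+1) \sum_(b < j.+1) P`_a`_b * Q`_(i - a)`_(j - b).
Proof. by rewrite coefM coef_sum; apply: eq_bigr => a _; rewrite coefM. Qed.

Let mul_coef n f g (P Q : {poly {poly K}}) :
  (forall i j, (i < n)%N -> (j < n)%N -> P`_i`_j = coef2 f i j) ->
  (forall i j, (i < n)%N -> (j < n)%N -> Q`_i`_j = coef2 g i j) ->
  forall i j, (i < n)%N -> (j < n)%N ->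
  (P * Q)`_i`_j = coef2 (fps2_mul f g) i j.
Proof.
move=> Pf Qg i j ltin ltjn; rewrite coefM2 /=.
apply: eq_bigr => a _; apply: eq_bigr => b _.
rewrite Pf ?Qg //.
- exact: leq_ltn_trans (leq_subr _ _) ltin.
- exact: leq_ltn_trans (leq_subr _ _) ltjn.
- exact: leq_trans (ltn_ord a) ltin.
- exact: leq_trans (ltn_ord b) ltjn.
Qed.

Lemma fps2_mulA : associative fps2_mul.
Proof.
move=> f g h; apply: fps2P => i j.
pose n := (maxn i j).+1.
have ltin : (i < n)%N by rewrite ltnS leq_maxl.
have ltjn : (j < n)%N by rewrite ltnS leq_maxr.
rewrite -(mul_coef (@trunc_coef n f)
           (mul_coef (@trunc_coef n g) (@trunc_coef n h)) ltin ltjn).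
by rewrite mulrA (mul_coef
  (mul_coef (@trunc_coef n f) (@trunc_coef n g)) (@trunc_coef n h) ltin ltjn).
Qed.

Lemma fps2_mulC : commutative fps2_mul.
Proof.
move=> f g; apply: fps2P => i j.
pose n := (maxn i j).+1.
have ltin : (i < n)%N by rewrite ltnS leq_maxl.
have ltjn : (j < n)%N by rewrite ltnS leq_maxr.
rewrite -(mul_coef (@trunc_coef n f) (@trunc_coef n g) ltin ltjn).
by rewrite mulrC (mul_coef (@trunc_coef n g) (@trunc_coef n f) ltin ltjn).
Qed.

Lemma fps2_mul1 : left_id fps2_one fps2_mul.
Proof.
move=> f; apply: fps2P => i j /=.
rewrite big_ord_recl big_ord_recl /= mul1r !subn0.
rewrite big1 => [|b _]; last by rewrite mul0r.
rewrite big1 ?addr0 // => a _.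
by rewrite big1 // => b _; rewrite mul0r.
Qed.

Lemma fps2_mulDl : left_distributive fps2_mul fps2_add.
Proof.
move=> f g h; apply: fps2P => i j /=.
rewrite -big_split; apply: eq_bigr => a _ /=.
by rewrite -big_split; apply: eq_bigr => b _ /=; rewrite mulrDl.
Qed.

Lemma fps2_one_neq0 : fps2_one != fps2_zero.
Proof.
apply/eqP => /(congr1 (fun f => coef2 f 0 0)) /eqP /=.
by rewrite oner_eq0.
Qed.

HB.instance Definition _ := GRing.Zmodule_isComNzRing.Build (fps2 K)
  fps2_mulA fps2_mulC fps2_mul1 fps2_mulDl fps2_one_neq0.

Lemma fps2_scaleA a b f :
  fps2_scale a (fps2_scale b f) = fps2_scale (a * b) f.
Proof. by apply: fps2P => i j /=; rewrite mulrA. Qed.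
Lemma fps2_scale1 : left_id 1 fps2_scale.
Proof. by move=> f; apply: fps2P => i j /=; rewrite mul1r. Qed.
Lemma fps2_scaleDr : right_distributive fps2_scale +%R.
Proof. by move=> a f g; apply: fps2P => i j /=; rewrite mulrDr. Qed.
Lemma fps2_scaleDl f : {morph fps2_scale^~ f : a b / a + b}.
Proof. by move=> a b; apply: fps2P => i j /=; rewrite mulrDl. Qed.

HB.instance Definition _ := GRing.Zmodule_isLmodule.Build K (fps2 K)
  fps2_scaleA fps2_scale1 fps2_scaleDr fps2_scaleDl.

Lemma fps2_scaleAl (a : K) f g : a *: (f * g) = a *: f * g.
Proof.
apply: fps2P => i j /=; rewrite big_distrr; apply: eq_bigr => k _ /=.
by rewrite big_distrr; apply: eq_bigr => l _ /=; rewrite mulrA.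
Qed.

HB.instance Definition _ := GRing.Lmodule_isLalgebra.Build K (fps2 K)
  fps2_scaleAl.
HB.instance Definition _ := GRing.Lalgebra_isComAlgebra.Build K (fps2 K).

Definition fps2_unit : {pred fps2 K} := fun f => `[< exists g, g * f = 1 >].
Definition fps2_inv f := xget f [set g | g * f = 1].

Lemma fps2_mulVx : {in fps2_unit, left_inverse 1 fps2_inv *%R}.
Proof. by move=> f /asboolP [g gf]; exact: (@xgetI _ f [set g | g * f = 1] g gf). Qed.
Lemma fps2_unitPl f g : g * f = 1 -> fps2_unit f.
Proof. by move=> gf; apply/asboolP; exists g. Qed.
Lemma fps2_invr_out : {in [predC fps2_unit], fps2_inv =1 id}.
Proof.
move=> f /asboolP fNU; apply: xgetPN => g gf.
by apply: fNU; exists g.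
Qed.

HB.instance Definition _ := GRing.ComNzRing_hasMulInverse.Build (fps2 K)
  fps2_mulVx fps2_unitPl fps2_invr_out.

Definition fpsX : fps2 K := Fps2 (fun i j => ((i == 1%N) && (j == 0%N))%:R).
Definition fpsY : fps2 K := Fps2 (fun i j => ((i == 0%N) && (j == 1%N))%:R).

Definition fps2_dx f := Fps2 (fun i j => coef2 f i.+1 j *+ i.+1).
Definition fps2_dy f := Fps2 (fun i j => coef2 f i j.+1 *+ j.+1).

End Fps2Ring.

Arguments fpsX {K}.
Arguments fpsY {K}.

Section Factorization.
Variable R : comUnitRingType.
Implicit Types f g q : R.

Definition divides g f := exists h, f = h * g.

Definition irreducible f :=
  [/\ f <> 0, f \isn't a GRing.unit &
      forall g h, f = g * h -> g \is a GRing.unit \/ h \is a GRing.unit].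

Definition reduced f :=
  f <> 0 /\ forall q, irreducible q -> ~ divides (q ^+ 2) f.

(* f = f_1 ... f_r up to a unit; the unit lets r = 0 cover f a unit. *)
Definition is_factorization f (s : seq R) :=
  {in s, forall q, irreducible q} /\
  exists2 u : R, u \is a GRing.unit & f = u * \prod_(q <- s) q.

Definition factors f : seq R := xget [::] [set s | is_factorization f s].

Definition ideal2 f g : set R := [set h | exists a b, h = a * f + b * g].

End Factorization.

(* dim_K (V / W), with value +oo when the quotient has no finite basis. *)
Section Codimension.
Variables (K : fieldType) (V : lmodType K).

Definition quotient_basis (W : set V) n (e : 'I_n -> V) :=
  forall h : V, exists! c : 'I_n -> K, W (h - \sum_i c i *: e i).

Definition codim (W : set V) : \bar int :=
  xget +oo%E
    [set d | exists n, d = (n%:Z)%:E /\ exists e : 'I_n -> V, quotient_basis W e].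

End Codimension.

(* p = 0 or p prime. *)
Definition has_char (K : fieldType) (p : nat) :=
  (p = 0%N /\ [pchar K] =i pred0) \/ p \in [pchar K].

Section Invariants.
Variable K : fieldType.
Implicit Types f g : fps2 K.

Definition imult f g : \bar int := codim (ideal2 f g).

Definition maxideal_pow (k : nat) : set (fps2 K) :=
  [set f | exists c : 'I_k.+1 -> fps2 K,
     f = \sum_(i < k.+1) c i * (fpsX ^+ i * fpsY ^+ (k - i))].

(* Only meaningful for f <> 0. *)
Definition mt f : nat :=
  xget 0%N [set k | maxideal_pow k f /\
                    forall l, maxideal_pow l f -> (l <= k)%N].

(* P holds at all but finitely many points (a : b) of P^1(K), these being the
   nonempty Zariski open subsets of P^1; (a : b) = (c : d) iff a d = b c. *)
Definition generic_P1 (P : K -> K -> Prop) :=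
  exists2 s : seq (K * K), (0, 0) \notin s &
    forall a b : K, (a, b) != (0, 0) ->
      {in s, forall q, a * q.2 != b * q.1} -> P a b.

Definition kappa f : \bar int :=
  xget 0%E [set v | generic_P1 (fun a b =>
                      imult f (a *: fps2_dx f + b *: fps2_dy f) = v)].

Local Open Scope ereal_scope.

Definition convenient f := imult f fpsX < +oo /\ imult f fpsY < +oo.

(* An irreducible f that is not convenient is a unit times x or y, where the
   value is 0. *)
Definition gamma_tilde_irr f : \bar int :=
  if `[< convenient f >] then
    Order.min (imult f (fps2_dx f) - imult f fpsY + 1)
              (imult f (fps2_dy f) - imult f fpsX + 1)
  else 0.

Definition gamma_tilde_factors (s : seq (fps2 K)) : \bar int :=
  \sum_(i < size s)
     (gamma_tilde_irr s`_i + \sum_(j < size s | j != i) imult s`_i s`_j)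
  - ((size s)%:Z)%:E + 1.

Definition gamma_tilde f : \bar int := gamma_tilde_factors (factors f).

Definition right_equiv f g :=
  exists Phi : {lrmorphism fps2 K -> fps2 K}, bijective Phi /\ f = Phi g.

Definition gamma f : \bar int :=
  xget +oo [set v | (exists2 g, right_equiv f g & gamma_tilde g = v) /\
                    forall g, right_equiv f g -> v <= gamma_tilde g].

Definition m_good (p : nat) f :=
  forall s, is_factorization f s -> {in s, forall q, ~~ (p %| mt q)%N}.

End Invariants.

(* Main.v *)
(* For f irreducible, v = i(f, -) is a valuation. This is proved by resolving f:
   a blow-up (x, y) -> (x, xy) after a suitable linear change embeds K[[x,y]]/f
   with finite colength into K[[x,y]]/f1, f1 the strict transform, so that v is
   the pullback of the valuation of f1; irreducibility of f forces f1 to be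
   irreducible again, and the process stops at a smooth curve because f cannot
   have infinite contact with one. Along the way one carries the inequality
   v(J(f,g)) - v(g) <= v(J(f,h)) - v(h) for p not dividing v(g), where J is the
   Jacobian determinant.

   On a branch q, v(alpha q_x + beta q_y) is generically
   min(v(q_x), v(q_y)), so kappa is the sum over the factors f_i of this minimum
   and of the i(f_i, f_j), j <> i. With mt(q) = min(v(x), v(y)) the upper bound
   follows factor by factor; if p does not divide mt(q), the inequality above for
   {g, h} = {x, y} orders v(q_x) - v(y) and v(q_y) - v(x) and yields equality.
   The kappa invariant and mt are preserved by automorphisms, hence gamma =
   gamma~ in the m-good case. In general the minimum defining gamma exists
   because v(q_x) >= v(y) - 1, which makes gamma~ at least 1 - mt. *)

From HB Require Import structures.
Require Import Defs.
From mathcomp Require Import all_boot all_order all_algebra.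
From mathcomp Require Import boolp classical_sets constructive_ereal.
From mathcomp Require Import zify ring.

Set Implicit Arguments.
Unset Strict Implicit.
Unset Printing Implicit Defensive.

Import Order.TTheory GRing.Theory Num.Theory.
Local Open Scope ring_scope.

(** * Coefficients, weights and multiplicity *)

(** No parametrization of a branch is constructed. What one would provide is packed into the four
    properties of [branch], chosen because each of them descends through one blow-up, where only an
    embedding of finite colength is at hand. The Jacobian property has to compare two series: a
    substitution multiplies the Jacobian of (f, h) by its own Jacobian determinant, a shift that
    does not depend on h and therefore cancels.

    Irreducibility of the strict transform rests on Weierstrass polynomials: a factor that is a
    polynomial in y can be homogenized back to a factor of f. Algebraic closedness gives a direction
    outside the tangent cone, which makes f regular in y of order [mt f]; a root of the tangent
    cone, which moves the tangent to y = 0; and enough directions for kappa to be well defined. The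
    multiplicity need not drop in a blow-up, hence a second induction, on the order of contact with
    smooth curves y = x t(x). *)

Section Coefficients.
Variable K : fieldType.
Implicit Types (f g h : fps2 K) (c : K).

Lemma coef2D f g i j : coef2 (f + g) i j = coef2 f i j + coef2 g i j.
Proof. by []. Qed.
Lemma coef2N f i j : coef2 (- f) i j = - coef2 f i j.
Proof. by []. Qed.
Lemma coef2B f g i j : coef2 (f - g) i j = coef2 f i j - coef2 g i j.
Proof. by []. Qed.
Lemma coef20 i j : coef2 (0 : fps2 K) i j = 0.
Proof. by []. Qed.
Lemma coef21 i j : coef2 (1 : fps2 K) i j = ((i == 0%N) && (j == 0%N))%:R.
Proof. by []. Qed.
Lemma coef2Z c f i j : coef2 (c *: f) i j = c * coef2 f i j.
Proof. by []. Qed.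
Lemma coef2M f g i j : coef2 (f * g) i j =
  \sum_(a < i.+1) \sum_(b < j.+1) coef2 f a b * coef2 g (i - a)%N (j - b)%N.
Proof. by []. Qed.
Lemma coef2_sum I (r : seq I) (P : pred I) (F : I -> fps2 K) i j :
  coef2 (\sum_(k <- r | P k) F k) i j = \sum_(k <- r | P k) coef2 (F k) i j.
Proof. exact: (big_morph (fun f => coef2 f i j) (fun _ _ => erefl) erefl). Qed.

Lemma coef2M0 f g : coef2 (f * g) 0 0 = coef2 f 0 0 * coef2 g 0 0.
Proof. by rewrite coef2M !big_ord1. Qed.

Lemma coef2XM f i j :
  coef2 (fpsX * f) i j = if i is i'.+1 then coef2 f i' j else 0.
Proof.
rewrite coef2M; case: i => [|i].
  by rewrite big_ord1 big1 // => b _; rewrite /= mul0r.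
rewrite 2!big_ord_recl /= big1 ?add0r; last first.
  by move=> b _; rewrite mul0r.
rewrite [X in _ + X]big1 ?addr0; last first.
  by move=> a _; rewrite big1 // => b _; rewrite mul0r.
rewrite big_ord_recl /= big1 ?addr0; last by move=> b _; rewrite mul0r.
by rewrite mul1r subn1 subn0.
Qed.

Lemma coef2YM f i j :
  coef2 (fpsY * f) i j = if j is j'.+1 then coef2 f i j' else 0.
Proof.
rewrite coef2M big_ord_recl /= [X in _ + X]big1 ?addr0; last first.
  by move=> a _; rewrite big1 // => b _; rewrite mul0r.
case: j => [|j]; first by rewrite big_ord1 /= mul0r.
rewrite 2!big_ord_recl /= mul0r add0r big1 ?addr0; last first.
  by move=> b _; rewrite mul0r.
by rewrite mul1r subn1 subn0.
Qed.

Lemma coef2XnM n f i j :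
  coef2 (fpsX ^+ n * f) i j = if (n <= i)%N then coef2 f (i - n)%N j else 0.
Proof.
elim: n i => [|n IH] i; first by rewrite mul1r subn0.
by rewrite exprS -mulrA coef2XM; case: i => [|i].
Qed.

Lemma coef2YnM n f i j :
  coef2 (fpsY ^+ n * f) i j = if (n <= j)%N then coef2 f i (j - n)%N else 0.
Proof.
elim: n j => [|n IH] j; first by rewrite mul1r subn0.
by rewrite exprS -mulrA coef2YM; case: j => [|j].
Qed.

Lemma coef2_monomial k l i j :
  coef2 (fpsX ^+ k * fpsY ^+ l : fps2 K) i j = ((i == k) && (j == l))%:R.
Proof.
rewrite coef2XnM -[fpsY ^+ l]mulr1 coef2YnM coef21.
case: leqP => ki; last by rewrite (ltn_eqF ki).
case: leqP => lj; last by rewrite (ltn_eqF lj) andbF.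
by rewrite !subn_eq0 !eqn_leq ki lj !andbT.
Qed.

(** Here x has weight 1 and y has weight k. The case k = 1 gives the powers of the maximal ideal,
    larger k the slopes of the Newton polygon used in [contact]. *)
Definition wt (k w : nat) f := forall i j, (i + k * j < w)%N -> coef2 f i j = 0.

Lemma wt_le k w w' f : (w' <= w)%N -> wt k w f -> wt k w' f.
Proof. by move=> le fw i j lt; apply: fw; apply: leq_trans lt le. Qed.
Lemma wt0 k f : wt k 0 f. Proof. by []. Qed.
Lemma wt_zero k w : wt k w 0. Proof. by []. Qed.
Lemma wtD k w f g : wt k w f -> wt k w g -> wt k w (f + g).
Proof. by move=> hf hg i j lt; rewrite coef2D hf ?hg ?addr0. Qed.
Lemma wtN k w f : wt k w f -> wt k w (- f).
Proof. by move=> hf i j lt; rewrite coef2N hf ?oppr0. Qed.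
Lemma wtB k w f g : wt k w f -> wt k w g -> wt k w (f - g).
Proof. by move=> hf hg; apply: wtD => //; apply: wtN. Qed.
Lemma wtZ k w c f : wt k w f -> wt k w (c *: f).
Proof. by move=> hf i j lt; rewrite coef2Z hf ?mulr0. Qed.
Lemma wt_sum I (r : seq I) (P : pred I) (F : I -> fps2 K) k w :
  (forall a, P a -> wt k w (F a)) -> wt k w (\sum_(a <- r | P a) F a).
Proof.
by move=> hF; apply: (big_ind (wt k w)) => [//|f g|//]; exact: wtD.
Qed.

Lemma wtM k v w f g : wt k v f -> wt k w g -> wt k (v + w) (f * g).
Proof.
move=> hf hg i j lt; rewrite coef2M big1 // => a _; rewrite big1 // => b _.
have [ltv|lev] := ltnP (a + k * b) v; first by rewrite hf ?mul0r.
rewrite [X in _ * X]hg ?mulr0 //.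
have := ltn_ord a; have := ltn_ord b; rewrite !ltnS => hb ha.
have : (k * (j - b) + k * b = k * j)%N by rewrite -mulnDr subnK.
by lia.
Qed.

Lemma wtMl k w f g : wt k w g -> wt k w (f * g).
Proof. by move=> hg; rewrite -[w]add0n; apply: wtM. Qed.
Lemma wtMr k w f g : wt k w f -> wt k w (f * g).
Proof. by rewrite mulrC; apply: wtMl. Qed.

Lemma wtX k v f n : wt k v f -> wt k (n * v) (f ^+ n).
Proof.
move=> hf; elim: n => [|n IH]; first exact: wt0.
by rewrite exprS mulSn; apply: wtM.
Qed.

(* Membership in the N-th power of the maximal ideal. *)
Definition inm := wt 1.

Lemma inm_wt k w f : (0 < k)%N -> inm w f -> wt k w f.
Proof. by move=> k0 hf i j lt; apply: hf; nia. Qed.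

Lemma inm1 f : inm 1 f <-> coef2 f 0 0 = 0.
Proof.
split=> [h|h [|i] [|j] lt //]; [exact: h | lia..].
Qed.

Lemma inmX : inm 1 (fpsX : fps2 K). Proof. exact/inm1. Qed.
Lemma inmY : inm 1 (fpsY : fps2 K). Proof. exact/inm1. Qed.

Lemma inm_eq0 f g : (forall N, inm N (f - g)) -> f = g.
Proof.
move=> h; apply: fps2P => i j; apply/eqP; rewrite -subr_eq0 -coef2B.
by apply/eqP; apply: (h (i + j).+1); rewrite mul1n.
Qed.

Lemma coef2_low0 m n f g : inm m f -> inm n g ->
  coef2 (f * g) 0 (m + n) = coef2 f 0 m * coef2 g 0 n.
Proof.
move=> hf hg; rewrite coef2M big_ord1 subn0.
have lt : (m < (m + n).+1)%N by lia.
rewrite (bigD1 (Ordinal lt)) //= addKn big1 ?addr0 // => b /eqP nb.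
have {}nb : (b : nat) <> m by move=> e; apply: nb; apply: val_inj.
have := ltn_ord b; rewrite ltnS => lb.
have [bm|mb] := ltnP b m; first by rewrite hf ?mul0r //; lia.
by rewrite [X in _ * X]hg ?mulr0 //; lia.
Qed.

Lemma coef2_lowX0 m f n : inm m f -> coef2 (f ^+ n) 0 (n * m) = coef2 f 0 m ^+ n.
Proof.
move=> hf; elim: n => [|n IH]; first by rewrite !expr0 coef21.
by rewrite !exprS mulSn coef2_low0 ?IH //; apply: wtX.
Qed.

(* The geometric series of h, summed coefficientwise. *)
Lemma unit_inv1 h : inm 1 h -> exists g, g * (1 - h) = 1.
Proof.
move=> hm; exists (Fps2 (fun i j => coef2 (\sum_(k < (i + j).+1) h ^+ k) i j)).
set g := Fps2 _.
have gE N : inm N (g - \sum_(k < N) h ^+ k).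
  move=> i j lt; rewrite coef2B /=.
  have le : ((i + j).+1 <= N)%N by lia.
  rewrite -(subnKC le) [X in _ - coef2 X _ _]big_split_ord coef2D opprD addrA.
  rewrite subrr add0r -coef2N.
  apply: (@wtN 1 (i + j).+1); last by lia.
  apply: wt_sum => k _; rewrite exprD; apply: wtMr.
  by have := @wtX 1 1 h (i + j).+1 hm; rewrite muln1.
apply: inm_eq0 => N.
have -> : g * (1 - h) - 1 = (g - \sum_(k < N) h ^+ k) * (1 - h) - h ^+ N.
  have e : (\sum_(k < N) h ^+ k) * (1 - h) = 1 - h ^+ N.
    rewrite mulrC -opprB mulNr -subrX1 opprB //.
  by rewrite mulrBl e; ring.
apply: wtB; first exact: wtMr (gE N).
by have := @wtX 1 1 h N hm; rewrite muln1.
Qed.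

Lemma fps2_unitE f : (f \is a GRing.unit) = (coef2 f 0 0 != 0).
Proof.
apply/idP/idP => [/mulVr fV | f0].
  apply/eqP => f0; have := congr1 (fun u => coef2 u 0 0) fV.
  by rewrite coef2M0 f0 mulr0 coef21 /= => /eqP; rewrite eq_sym oner_eq0.
pose h := 1 - (coef2 f 0 0)^-1 *: f.
have hm : inm 1 h by apply/inm1; rewrite coef2B coef2Z coef21 mulVf ?subrr.
have [g] := unit_inv1 hm; rewrite opprB addrC subrK -scalerAr => e.
apply/unitrP; exists ((coef2 f 0 0)^-1 *: g); split.
  by rewrite -scalerAl.
by rewrite -scalerAr mulrC.
Qed.

Lemma nunitP f : (f \isn't a GRing.unit) <-> inm 1 f.
Proof. by rewrite fps2_unitE negbK inm1; split=> [/eqP|->]. Qed.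

Lemma order_exists f : f <> 0 -> exists m, inm m f /\ ~ inm m.+1 f.
Proof.
move=> f0; have [m hm] : exists m, ~ inm m f.
  apply: contrapT => h; apply: f0; apply: inm_eq0 => N.
  by rewrite subr0; apply: contrapT => hN; apply: h; exists N.
have : exists m, `[< ~ inm m f >] by exists m; apply/asboolP.
case/ex_minnP => [[|n]] /asboolP hn mn.
  by case: hn; exact: wt0.
exists n; split => //; apply: contrapT => h.
by have := mn n (introT (asboolP _) h); rewrite ltnn.
Qed.

Lemma not_inmS f m : inm m f -> ~ inm m.+1 f ->
  exists a, [/\ (a <= m)%N, coef2 f a (m - a)%N <> 0 &
    forall b, (b < a)%N -> coef2 f b (m - b)%N = 0].
Proof.
move=> h1 h2.
have [a ha] : exists a, `[< (a <= m)%N /\ coef2 f a (m - a)%N <> 0 >].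
  apply: contrapT => h; apply: h2 => i j; rewrite mul1n ltnS => le.
  have [e|ne] := eqVneq (i + j)%N m; last by apply: h1; lia.
  apply: contrapT => c; apply: h; exists i; apply/asboolP; split; first by lia.
  by rewrite (_ : (m - i)%N = j) //; lia.
have : exists a, `[< (a <= m)%N /\ coef2 f a (m - a)%N <> 0 >] by exists a.
case/ex_minnP => {ha}a /asboolP [am fa] mn; exists a; split => // b lt.
apply: contrapT => c; suff : (a <= b)%N by lia.
by apply/mn/asboolP; split => //; lia.
Qed.

(** In the product of the two initial forms, the product of the monomials with least x-exponent
    cannot be cancelled. *)
Lemma inm_mulN m n f g : inm m f -> ~ inm m.+1 f -> inm n g -> ~ inm n.+1 g ->
  inm (m + n) (f * g) /\ ~ inm (m + n).+1 (f * g).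
Proof.
move=> f1 f2 g1 g2; split; first exact: wtM.
have [a [am fa amin]] := not_inmS f1 f2.
have [b [bn gb bmin]] := not_inmS g1 g2.
move=> /(_ (a + b)%N (m - a + (n - b))%N); rewrite coef2M => H.
have lta : (a < (a + b).+1)%N by lia.
have ltb : (m - a < (m - a + (n - b)).+1)%N by lia.
have {}H := H ltac:(lia); move: H.
rewrite (bigD1 (Ordinal lta)) //= (bigD1 (Ordinal ltb)) //= !addKn.
rewrite big1 ?addr0; last first.
  move=> [j hj] /eqP nj; have {}nj : j <> (m - a)%N.
    by move=> e; apply: nj; apply: val_inj.
  rewrite /=; have [lt|ge] := ltnP j (m - a); first by rewrite f1 ?mul0r //; lia.
  by rewrite [X in _ * X]g1 ?mulr0 //; lia.
rewrite big1 ?addr0; last first.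
  move=> [i hi] /eqP ni; have {}ni : i <> a.
    by move=> e; apply: ni; apply: val_inj.
  rewrite big1 // => [[j hj]] _ /=.
  have [lt|] := ltnP (i + j) m; first by rewrite f1 ?mul0r //; lia.
  rewrite leq_eqVlt => /orP [/eqP e|gt]; last first.
    by rewrite [X in _ * X]g1 ?mulr0 //; lia.
  have [lt|ge] := ltnP i a.
    have := amin i lt; rewrite (_ : (m - i)%N = j); last by lia.
    by move->; rewrite mul0r.
  rewrite (_ : (m - a + (n - b) - j)%N = (n - (a + b - i))%N); last by lia.
  by rewrite [X in _ * X]bmin ?mulr0 //; lia.
by move/eqP; rewrite mulf_eq0 => /orP [] /eqP.
Qed.

Lemma fps2_mul_neq0 f g : f <> 0 -> g <> 0 -> f * g <> 0.
Proof.
move=> /order_exists [m [f1 f2]] /order_exists [n [g1 g2]] e.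
by have [_] := inm_mulN f1 f2 g1 g2; rewrite e; apply; exact: wt_zero.
Qed.

Lemma fps2_mulI f g h : f <> 0 -> f * g = f * h -> g = h.
Proof.
move=> f0 e; apply: contrapT => ne; apply: (@fps2_mul_neq0 f (g - h)) => //.
  by move/eqP; rewrite subr_eq0 => /eqP.
by rewrite mulrBr e subrr.
Qed.

Lemma divYn n f : (forall i j, (j < n)%N -> coef2 f i j = 0) ->
  exists h, f = fpsY ^+ n * h.
Proof.
move=> hf; exists (Fps2 (fun i j => coef2 f i (j + n)%N)).
apply: fps2P => i j; rewrite coef2YnM; case: leqP => [le|/hf ->//].
by rewrite /= subnK.
Qed.

Lemma divXn n f : (forall i j, (i < n)%N -> coef2 f i j = 0) ->
  exists h, f = fpsX ^+ n * h.
Proof.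
move=> hf; exists (Fps2 (fun i j => coef2 f (i + n)%N j)).
apply: fps2P => i j; rewrite coef2XnM; case: leqP => [le|lt]; last by rewrite hf.
by rewrite /= subnK.
Qed.

Lemma inm_decomp N f : inm N.+1 f ->
  exists a b, [/\ inm N a, inm N b & f = a * fpsX + b * fpsY].
Proof.
move=> hf.
exists (Fps2 (fun i j => coef2 f i.+1 j)),
  (Fps2 (fun i j => if i is 0%N then coef2 f i j.+1 else 0)).
split=> [i j lt|[|i] j lt|] /=; [by apply: hf; lia| by apply: hf; lia | by [] |].
apply: fps2P => i j; rewrite mulrC coef2D coef2XM mulrC coef2YM.
case: i => [|i] /=; last by case: j => [|j] /=; rewrite addr0.
by case: j => [|j] /=; rewrite add0r // hf.
Qed.

Lemma maxideal_powP N f : maxideal_pow N f <-> inm N f.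
Proof.
split=> [[c ->]|].
  apply: wt_sum => i _; apply: wtMl => a b lt.
  rewrite coef2_monomial; case: andP => // -[/eqP ea /eqP eb].
  by have := ltn_ord i; lia.
elim: N f => [|N IH] f hf.
  by exists (fun _ => f); rewrite big_ord1 !expr0 !mulr1.
have [a [b [/IH [c ->] /IH [d ->] ->]]] := inm_decomp hf.
(* A factor x raises the index of a monomial by one, as [lift ord0] does; a factor y keeps it, as
   [lift ord_max] does. *)
exists (fun i => (if unlift ord_max i is Some i' then d i' else 0)
               + (if unlift ord0 i is Some i' then c i' else 0)).
under [RHS]eq_bigr => i _ do rewrite mulrDl.
rewrite big_split /= addrC; congr (_ + _).
  rewrite [RHS]big_ord_recl /= unlift_none mul0r add0r mulr_suml.
  apply: eq_bigr => i _; rewrite liftK -mulrA; congr (_ * _).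
  by rewrite mulrAC -exprSr /= /bump /= add1n subSS.
rewrite [RHS]big_ord_recr /= unlift_none mul0r addr0 mulr_suml.
apply: eq_bigr => i _.
have -> : widen_ord (leqnSn N.+1) i = lift ord_max i.
  by apply: val_inj; rewrite /= /bump leqNgt ltn_ord.
rewrite liftK -mulrA; congr (_ * _).
by rewrite -mulrA -exprSr subSn // -ltnS ltn_ord.
Qed.

Lemma mtP f m : inm m f -> ~ inm m.+1 f -> mt f = m.
Proof.
move=> h1 h2; rewrite /mt.
have mP : maxideal_pow m f /\ forall l, maxideal_pow l f -> (l <= m)%N.
  split=> [|l /maxideal_powP hl]; first exact/maxideal_powP.
  by rewrite leqNgt; apply/negP => lt; apply: h2; apply: wt_le hl.
have [] := xgetPex 0%N (ex_intro (fun k => maxideal_pow k f /\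
  forall l, maxideal_pow l f -> (l <= k)%N) m mP).
set n := xget _ _ => /maxideal_powP hn mn.
apply/eqP; rewrite eqn_leq mP.2; last exact/maxideal_powP.
by apply/mn/maxideal_powP.
Qed.

Lemma mt_inm f : f <> 0 -> inm (mt f) f /\ ~ inm (mt f).+1 f.
Proof. by move=> /order_exists [m [h1 h2]]; rewrite (mtP h1 h2). Qed.

Lemma mtM f g : f <> 0 -> g <> 0 -> mt (f * g) = (mt f + mt g)%N.
Proof.
move=> /mt_inm [f1 f2] /mt_inm [g1 g2].
by have [h1 h2] := inm_mulN f1 f2 g1 g2; exact: mtP.
Qed.

Lemma unit_neq0 f : f \is a GRing.unit -> f <> 0.
Proof. by rewrite fps2_unitE => /eqP h e; apply: h; rewrite e coef20. Qed.

Lemma mt_unit f : f \is a GRing.unit -> mt f = 0%N.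
Proof.
by move=> fu; apply: mtP => [|/nunitP]; [exact: wt0 | rewrite fu].
Qed.

Lemma mt_gt0 f : f <> 0 -> f \isn't a GRing.unit -> (0 < mt f)%N.
Proof.
move=> /mt_inm [_ h] /nunitP fn; case: (mt f) h => [|//] h.
by case: h.
Qed.

End Coefficients.

Opaque fps2_mul.

(** * Endomorphisms of K[[x,y]] and the chain rule *)

Section Morphisms.
Variable K : fieldType.
Implicit Types (f g h : fps2 K) (Phi Psi : {lrmorphism fps2 K -> fps2 K}).

(** The value at (a, b) of the truncation of g to exponents below N. For a and b in the maximal
    ideal it agrees with g(a, b) modulo the N-th power of that ideal, which replaces convergence. *)
Definition ev N (a b : fps2 K) g :=
  \sum_(p : 'I_N * 'I_N) coef2 g p.1 p.2 *: (a ^+ p.1 * b ^+ p.2).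

Lemma ev_linear N a b : linear (ev N a b).
Proof.
move=> c g h; rewrite /ev scaler_sumr -big_split /=; apply: eq_bigr => p _.
by rewrite scalerA -scalerDl.
Qed.

Lemma evD N a b g h : ev N a b (g + h) = ev N a b g + ev N a b h.
Proof. by rewrite -[g]scale1r ev_linear !scale1r. Qed.

Lemma ev0 N a b : ev N a b 0 = 0.
Proof. by rewrite /ev big1 // => p _; rewrite scale0r. Qed.

Lemma evZ N a b c g : ev N a b (c *: g) = c *: ev N a b g.
Proof.
by rewrite -[_ *: _]addr0 ev_linear ev0 addr0.
Qed.

Lemma evB N a b g h : ev N a b (g - h) = ev N a b g - ev N a b h.
Proof. by rewrite evD -scaleN1r evZ scaleN1r. Qed.

Lemma ev_sum N a b I (r : seq I) (F : I -> fps2 K) :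
  ev N a b (\sum_(i <- r) F i) = \sum_(i <- r) ev N a b (F i).
Proof.
by elim/big_rec2: _ => [|i y x _ <-]; rewrite ?ev0 ?evD.
Qed.

Lemma ev_monomial N a b k l : ev N a b (fpsX ^+ k * fpsY ^+ l) =
  if (k < N)%N && (l < N)%N then a ^+ k * b ^+ l else 0.
Proof.
rewrite /ev; case: ifP => [/andP [kN lN]|kl].
  rewrite (bigD1 (Ordinal kN, Ordinal lN)) // coef2_monomial !eqxx scale1r.
  rewrite big1; first by rewrite /= addr0.
  move=> -[p q]; rewrite coef2_monomial /=.
  case: andP => [[/eqP e1 /eqP e2]|_ _]; last by rewrite scale0r.
  by case/eqP; congr pair; apply: val_inj.
rewrite big1 // => -[p q] _; rewrite coef2_monomial /=.
case: andP => [[/eqP e1 /eqP e2]|_]; last by rewrite scale0r.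
by move: kl; rewrite -e1 -e2 !ltn_ord.
Qed.

Lemma ev_inm N M a b g : inm 1 a -> inm 1 b -> inm M g -> inm M (ev N a b g).
Proof.
move=> ha hb hg; apply: wt_sum => -[p q] _ /=.
have [lt|ge] := ltnP (p + q) M; first by rewrite hg ?mul1n // scale0r.
apply: wtZ; apply: (wt_le ge); apply: wtM.
  by have := @wtX _ 1 1 a p ha; rewrite muln1.
by have := @wtX _ 1 1 b q hb; rewrite muln1.
Qed.

Lemma trunc_inm N g : inm N (g - ev N fpsX fpsY g).
Proof.
move=> i j lt; rewrite coef2B /ev coef2_sum.
have iN : (i < N)%N by lia.
have jN : (j < N)%N by lia.
rewrite (bigD1 (Ordinal iN, Ordinal jN)) // coef2Z coef2_monomial !eqxx mulr1.
rewrite big1; first by rewrite /= addr0 subrr.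
move=> -[p q]; rewrite coef2Z coef2_monomial /=.
case: andP => [[/eqP e1 /eqP e2]|_ _]; last by rewrite mulr0.
by case/eqP; congr pair; apply: val_inj.
Qed.

Lemma ev_trunc N M a b g : (N <= M)%N ->
  ev M a b (ev N fpsX fpsY g) = ev N a b g.
Proof.
move=> NM; rewrite {2 3}/ev ev_sum; apply: eq_bigr => p _.
by rewrite evZ ev_monomial !(leq_trans (ltn_ord _) NM).
Qed.

Lemma ev_stable N M a b g : inm 1 a -> inm 1 b -> (N <= M)%N ->
  inm N (ev M a b g - ev N a b g).
Proof.
move=> ha hb NM; rewrite -(ev_trunc a b g NM) -evB.
by apply: ev_inm => //; apply: trunc_inm.
Qed.

(** Bilinearity reduces to two monomials. Either their total degree is at least N and all terms lie
    in the N-th power, or all exponents are below N and nothing is truncated. *)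
Lemma ev_mul N a b g h : inm 1 a -> inm 1 b ->
  inm N (ev N a b (g * h) - ev N a b g * ev N a b h).
Proof.
move=> ha hb; pose Q g h := inm N (ev N a b (g * h) - ev N a b g * ev N a b h).
rewrite -/(Q g h).
have QC u v : Q u v -> Q v u by rewrite /Q mulrC [ev N a b v * _]mulrC.
have QD u u' v : Q u v -> Q u' v -> Q (u + u') v.
  move=> h1 h2; rewrite /Q mulrDl (evD _ _ _ (u * v)) (evD _ _ _ u) mulrDl.
  by rewrite opprD addrACA; apply: wtD.
have QZ c u v : Q u v -> Q (c *: u) v.
  by move=> h1; rewrite /Q -scalerAl !evZ -scalerAl -scalerBr; apply: wtZ.
have Qinm u v : inm N u -> Q u v.
  by move=> hu; apply: wtB; [|apply: wtMr]; apply: ev_inm => //; apply: wtMr.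
have Qev u v : (forall k l, Q (fpsX ^+ k * fpsY ^+ l) v) -> Q u v.
  move=> hQ; rewrite -[u](subrK (ev N fpsX fpsY u)); apply: (QD).
    exact/Qinm/trunc_inm.
  apply: (big_ind (Q^~ v)) => [|x y|p _]; [exact/Qinm/wt_zero | exact: QD | exact: QZ].
apply: (Qev) => k l; apply: QC; apply: (Qev) => k' l'; rewrite /Q.
have -> : (fpsX ^+ k' * fpsY ^+ l') * (fpsX ^+ k * fpsY ^+ l) =
    fpsX ^+ (k' + k) * fpsY ^+ (l' + l) :> fps2 K.
  by rewrite !exprD; ring.
have pow (m n m' n' : nat) : inm N (a ^+ m * b ^+ n * (a ^+ m' * b ^+ n'))
    \/ (m + n + m' + n' < N)%N.
  have [lt|ge] := ltnP (m + n + m' + n') N; [by right | left].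
  apply: (wt_le ge); rewrite -addnA; apply: wtM; apply: wtM.
  - by have := @wtX _ 1 1 a m ha; rewrite muln1.
  - by have := @wtX _ 1 1 b n hb; rewrite muln1.
  - by have := @wtX _ 1 1 a m' ha; rewrite muln1.
  - by have := @wtX _ 1 1 b n' hb; rewrite muln1.
have [hp|lt] := pow k' l' k l; last first.
  rewrite !ev_monomial.
  have [[-> -> ->] [-> -> ->]] : [/\ k < N, l < N & k' < N]%N /\
    [/\ l' < N, k' + k < N & l' + l < N]%N by split; split; lia.
  by rewrite !exprD mulrACA subrr; apply: wt_zero.
rewrite !ev_monomial; apply: wtB.
  by case: ifP => _; [rewrite !exprD mulrACA | apply: wt_zero].
by case: ifP => _; case: ifP => _; rewrite ?mul0r ?mulr0 //; apply: wt_zero.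
Qed.

(** The coefficient at (i, j) is read off at precision i + j + 1, from which on it is stable by
    [ev_stable]. *)
Lemma subst_exists (a b : fps2 K) : inm 1 a -> inm 1 b ->
  exists Phi, Phi fpsX = a /\ Phi fpsY = b.
Proof.
move=> ha hb.
pose S g : fps2 K := Fps2 (fun i j => coef2 (ev (i + j).+1 a b g) i j).
have SE N g : inm N (S g - ev N a b g).
  move=> i j lt; rewrite coef2B /=.
  have le : ((i + j).+1 <= N)%N by lia.
  have := ev_stable g ha hb le => /(_ i j); rewrite mul1n => /(_ (ltnSn _)).
  by rewrite coef2B => /eqP; rewrite subr_eq0 => /eqP ->; rewrite subrr.
have Slin : linear S.
  by move=> c g h; apply: fps2P => i j; rewrite /= evD evZ.
have Smul : monoid_morphism S.
  split.
    apply: fps2P => i j /=.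
    have e1 : (1 : fps2 K) = fpsX ^+ 0 * fpsY ^+ 0 by rewrite !expr0 mulr1.
    by rewrite [in LHS]e1 ev_monomial !expr0 mulr1.
  move=> g h; apply: inm_eq0 => N.
  have -> : S (g * h) - S g * S h = (S (g * h) - ev N a b (g * h))
     + (ev N a b (g * h) - ev N a b g * ev N a b h)
     - (S g - ev N a b g) * S h - ev N a b g * (S h - ev N a b h) by ring.
  apply: wtB; last exact: wtMl (SE _ _).
  apply: wtB; last exact: wtMr (SE _ _).
  by apply: wtD; [apply: SE | apply: ev_mul].
pose Phi : {lrmorphism fps2 K -> fps2 K} :=
  HB.pack S (GRing.isLinear.Build K (fps2 K) (fps2 K) _ S Slin)
    (GRing.isMonoidMorphism.Build (fps2 K) (fps2 K) S Smul).
(* Precision [N.+2] ensures that the exponent 1 is not truncated. *)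
exists Phi; split; apply: inm_eq0 => N; apply: (@wt_le _ 1 N.+2 N _ (leqW (leqnSn N))).
  have := SE N.+2 fpsX; rewrite -/(Phi fpsX); have e1 : (fpsX : fps2 K) = fpsX ^+ 1 * fpsY ^+ 0.
    by rewrite expr0 mulr1.
  by rewrite [X in ev _ _ _ X]e1 ev_monomial /= expr1 expr0 mulr1.
have := SE N.+2 fpsY; have e1 : (fpsY : fps2 K) = fpsX ^+ 0 * fpsY ^+ 1.
  by rewrite expr0 mul1r.
by rewrite [X in ev _ _ _ X]e1 ev_monomial /= expr1 expr0 mul1r.
Qed.

(** If Phi h had constant term c <> 0, then h - c would be a unit whose image is not one. Continuity
    of every algebra endomorphism follows, so x and y determine it ([hom_ext]). *)
Lemma hom_local Phi h : inm 1 h -> inm 1 (Phi h).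
Proof.
move=> hm; apply/inm1; set c := coef2 _ _ _; apply/eqP/negPn/negP => c0.
have : Phi (h - c *: 1) \is a GRing.unit.
  apply: rmorph_unit; rewrite fps2_unitE coef2B coef2Z coef21 mulr1.
  by rewrite (inm1 _).1 // sub0r oppr_eq0.
rewrite linearB linearZ rmorph1 fps2_unitE coef2B coef2Z coef21 mulr1 subrr.
by rewrite eqxx.
Qed.

Lemma hom_inm Phi N f : inm N f -> inm N (Phi f).
Proof.
elim: N f => [|N IH] f; first by move=> _; apply: wt0.
move=> /inm_decomp [a [b [/IH ha /IH hb ->]]]; rewrite rmorphD !rmorphM.
by rewrite -addn1; apply: wtD; apply: wtM => //; apply: hom_local;
  [exact: inmX | exact: inmY].
Qed.

Lemma hom_ev Phi N f : inm N (Phi f - ev N (Phi fpsX) (Phi fpsY) f).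
Proof.
have -> : ev N (Phi fpsX) (Phi fpsY) f = Phi (ev N fpsX fpsY f).
  by rewrite {2}/ev linear_sum; apply: eq_bigr => p _; rewrite linearZ rmorphM !rmorphXn.
by rewrite -rmorphB; apply: hom_inm; apply: trunc_inm.
Qed.

Lemma hom_ext Phi Psi : Phi fpsX = Psi fpsX -> Phi fpsY = Psi fpsY -> Phi =1 Psi.
Proof.
move=> eX eY f; apply: inm_eq0 => N.
have := wtB (@hom_ev Phi N f) (@hom_ev Psi N f); rewrite eX eY.
by congr (wt _ _ _); ring.
Qed.

Lemma hom_wt Phi k w f : (0 < k)%N -> wt k k (Phi fpsY) -> wt k w f ->
  wt k w (Phi f).
Proof.
move=> k0 hY hf.
have -> : Phi f = (Phi f - ev w (Phi fpsX) (Phi fpsY) f)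
   + ev w (Phi fpsX) (Phi fpsY) f by ring.
apply: wtD; first by apply: inm_wt => //; apply: hom_ev.
apply: wt_sum => -[p q] _ /=.
have [lt|ge] := ltnP (p + k * q) w; first by rewrite hf // scale0r.
apply: wtZ; apply: (wt_le ge); rewrite mulnC; apply: wtM; last exact: wtX.
have hX : wt k 1 (Phi fpsX) by apply: inm_wt => //; apply: hom_local; exact: inmX.
by have := @wtX _ k 1 _ p hX; rewrite muln1.
Qed.

(** The last field is continuity with the loss of one order; it carries the chain rule from
    polynomials to series. *)
Record derivation (D : fps2 K -> fps2 K) : Prop := {
  derD : forall f g, D (f + g) = D f + D g;
  derM : forall f g, D (f * g) = D f * g + f * D g;
  derZ : forall c f, D (c *: f) = c *: D f;
  der_inm : forall N f, inm N.+1 f -> inm N (D f) }.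

Lemma dx_derivation : derivation (@fps2_dx K).
Proof.
split=> [f g|f g|c f|N f hf].
- by apply: fps2P => i j; rewrite /= mulrnDl.
- apply: fps2P => i j; rewrite [LHS]/= coef2D !coef2M.
  have -> : \sum_(a < i.+1) \sum_(b < j.+1)
       coef2 (fps2_dx f) a b * coef2 g (i - a)%N (j - b)%N =
     \sum_(a < i.+2) \sum_(b < j.+1)
       coef2 f a b * coef2 g (i.+1 - a)%N (j - b)%N *+ a.
    rewrite [RHS]big_ord_recl /= [X in _ = X + _]big1 ?add0r; last first.
      by move=> b _; rewrite mulr0n.
    by apply: eq_bigr => a _; apply: eq_bigr => b _; rewrite mulrnAl.
  have -> : \sum_(a < i.+1) \sum_(b < j.+1)
       coef2 f a b * coef2 (fps2_dx g) (i - a)%N (j - b)%N =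
     \sum_(a < i.+2) \sum_(b < j.+1)
       coef2 f a b * coef2 g (i.+1 - a)%N (j - b)%N *+ (i.+1 - a).
    rewrite [RHS]big_ord_recr /= [X in _ = _ + X]big1 ?addr0; last first.
      by move=> b _; rewrite subnn mulr0n.
    apply: eq_bigr => a _; apply: eq_bigr => b _ /=.
    by rewrite mulrnAr subSn // -ltnS.
  rewrite -big_split -sumrMnl; apply: eq_bigr => a _ /=.
  rewrite -big_split -sumrMnl; apply: eq_bigr => b _ /=.
  by rewrite -mulrnDr subnKC // -ltnS.
- by apply: fps2P => i j; rewrite /= mulrnAr.
- by move=> i j lt /=; rewrite hf ?mul0rn //; lia.
Qed.

Lemma dy_derivation : derivation (@fps2_dy K).
Proof.
split=> [f g|f g|c f|N f hf].
- by apply: fps2P => i j; rewrite /= mulrnDl.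
- apply: fps2P => i j; rewrite [LHS]/= coef2D !coef2M -sumrMnl -big_split.
  apply: eq_bigr => a _ /=.
  have -> : \sum_(b < j.+1)
       (coef2 f a b.+1 *+ b.+1) * coef2 g (i - a)%N (j - b)%N =
     \sum_(b < j.+2) coef2 f a b * coef2 g (i - a)%N (j.+1 - b)%N *+ b.
    rewrite [RHS]big_ord_recl /= mulr0n add0r.
    by apply: eq_bigr => b _; rewrite mulrnAl.
  have -> : \sum_(b < j.+1)
       coef2 f a b * (coef2 g (i - a)%N (j - b)%N.+1 *+ (j - b)%N.+1) =
     \sum_(b < j.+2) coef2 f a b * coef2 g (i - a)%N (j.+1 - b)%N *+ (j.+1 - b).
    rewrite [RHS]big_ord_recr /= subnn mulr0n addr0.
    by apply: eq_bigr => b _ /=; rewrite mulrnAr subSn // -ltnS.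
  rewrite -big_split -sumrMnl; apply: eq_bigr => b _ /=.
  by rewrite -mulrnDr subnKC // -ltnS.
- by apply: fps2P => i j; rewrite /= mulrnAr.
- by move=> i j lt /=; rewrite hf ?mul0rn //; lia.
Qed.

Lemma dxX : fps2_dx (fpsX : fps2 K) = 1.
Proof. by apply: fps2P => -[|i] j //=; rewrite mul0rn. Qed.
Lemma dxY : fps2_dx (fpsY : fps2 K) = 0.
Proof. by apply: fps2P => i j /=; rewrite mul0rn. Qed.
Lemma dyX : fps2_dy (fpsX : fps2 K) = 0.
Proof. by apply: fps2P => i j /=; rewrite andbF mul0rn. Qed.
Lemma dyY : fps2_dy (fpsY : fps2 K) = 1.
Proof. by apply: fps2P => i [|j] //=; rewrite andbF mul0rn. Qed.

(** The defect E is additive, obeys the Leibniz rule along Phi and kills x and y, hence all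
    monomials; continuity does the rest. *)
Lemma chain_rule Phi D g : derivation D ->
  D (Phi g) = Phi (fps2_dx g) * D (Phi fpsX) + Phi (fps2_dy g) * D (Phi fpsY).
Proof.
move=> Dder; have [DD DM DZ DI] := Dder.
have [xD xM xZ xI] := dx_derivation; have [yD yM yZ yI] := dy_derivation.
pose E f := D (Phi f) - (Phi (fps2_dx f) * D (Phi fpsX)
                       + Phi (fps2_dy f) * D (Phi fpsY)).
suff E0 : E g = 0 by apply/eqP; rewrite -subr_eq0 -/(E g) E0.
have ED f h : E (f + h) = E f + E h.
  by rewrite /E xD yD !rmorphD DD; ring.
have EZ c f : E (c *: f) = c *: E f.
  by rewrite /E xZ yZ !linearZ DZ /= -!scalerAl -scalerDr -scalerBr.
have EM f h : E (f * h) = E f * Phi h + Phi f * E h.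
  by rewrite /E xM yM !rmorphD !rmorphM DM; ring.
have EX : E fpsX = 0 by rewrite /E dxX dyX rmorph1 rmorph0; ring.
have EY : E fpsY = 0 by rewrite /E dxY dyY rmorph1 rmorph0; ring.
have E1 : E 1 = 0.
  by have := EM 1 1; rewrite !mulr1 rmorph1 mulr1 mul1r => /eqP;
    rewrite -subr_eq0 opprD addNKr oppr_eq0 => /eqP.
have EXn f n : E f = 0 -> E (f ^+ n) = 0.
  by move=> h; elim: n => [|n IH]; rewrite ?exprS ?EM ?h ?IH ?mul0r ?mulr0 ?addr0.
apply: inm_eq0 => N; rewrite subr0.
have -> : g = (g - ev N.+1 fpsX fpsY g) + ev N.+1 fpsX fpsY g by ring.
rewrite ED; apply: wtD.
  have hN := @trunc_inm N.+1 g; set r := g - _ in hN *.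
  rewrite /E; apply: wtB; first by apply: DI; apply: hom_inm.
  apply: wtD; apply: wtMr; apply: hom_inm; [exact: xI | exact: yI].
rewrite /ev; rewrite (big_morph E ED (_ : E 0 = 0)); last first.
  by have := EZ 0 0; rewrite !scale0r.
apply: wt_sum => p _; rewrite EZ EM !EXn // mul0r mulr0 addr0 scaler0.
exact: wt_zero.
Qed.

Definition jac f h := fps2_dx f * fps2_dy h - fps2_dy f * fps2_dx h.

Lemma jacE f h : jac f h = fps2_dx f * fps2_dy h - fps2_dy f * fps2_dx h.
Proof. by []. Qed.

Lemma jacM e f h : jac (e * f) h = e * jac f h + f * jac e h.
Proof.
rewrite /jac (derM dx_derivation) (derM dy_derivation); ring.
Qed.

Lemma jac_hom Phi f h :
  jac (Phi f) (Phi h) = jac (Phi fpsX) (Phi fpsY) * Phi (jac f h).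
Proof.
rewrite {1 3}/jac (chain_rule Phi f dx_derivation) (chain_rule Phi h dx_derivation).
rewrite (chain_rule Phi f dy_derivation) (chain_rule Phi h dy_derivation) /jac.
by rewrite rmorphB !rmorphM; ring.
Qed.

End Morphisms.

Opaque jac.

(** * Codimension of subspaces *)

Section CodimensionTheory.
Variable K : fieldType.

Lemma free_rows_le k n (M : 'M[K]_(k, n)) :
  (forall v : 'rV_k, v *m M = 0 -> v = 0) -> (k <= n)%N.
Proof.
move=> h; suff /eqP <- : row_free M by exact: rank_leq_col.
rewrite -kermx_eq0; apply: contraT => /rowV0Pn [v /sub_kermxP vM /eqP []].
exact: h.
Qed.

Section OneSpace.
Variable V : lmodType K.
Implicit Types (W U : set V).

Definition subspace W := W 0 /\ forall a u v, W u -> W v -> W (a *: u + v).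

Lemma subspaceD W u v : subspace W -> W u -> W v -> W (u + v).
Proof. by move=> [_ h] hu hv; rewrite -[u]scale1r; apply: h. Qed.
Lemma subspaceZ W a u : subspace W -> W u -> W (a *: u).
Proof. by move=> [h0 h] hu; rewrite -[_ *: _]addr0; apply: h. Qed.
Lemma subspaceN W u : subspace W -> W u -> W (- u).
Proof. by move=> h hu; rewrite -scaleN1r; apply: subspaceZ. Qed.
Lemma subspaceB W u v : subspace W -> W u -> W v -> W (u - v).
Proof. by move=> h hu hv; apply: subspaceD => //; apply: subspaceN. Qed.
Lemma subspace_sum W I (r : seq I) (P : pred I) (F : I -> V) :
  subspace W -> (forall i, P i -> W (F i)) -> W (\sum_(i <- r | P i) F i).
Proof.
by move=> h hF; apply: (big_ind W) => [|u v|//]; [exact: h.1 | exact: subspaceD].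
Qed.

Definition indep W n (e : 'I_n -> V) :=
  forall c : 'I_n -> K, W (\sum_i c i *: e i) -> forall i, c i = 0.
Definition spans W n (e : 'I_n -> V) :=
  forall h : V, exists c : 'I_n -> K, W (h - \sum_i c i *: e i).

Lemma quotient_basisP W n (e : 'I_n -> V) : subspace W ->
  quotient_basis W e <-> indep W e /\ spans W e.
Proof.
move=> hW; split=> [h|[hi hs] v].
  split=> [c hc i|v]; last by have [c []] := h v; exists c.
  have [d [_ du]] := h 0.
  have -> : c = d.
    apply/esym/du; rewrite sub0r; exact: subspaceN.
  have <- : (fun=> 0) = d; last by [].
  apply/esym/du; rewrite big1 ?subr0; first exact: hW.1.
  by move=> j _; rewrite scale0r.
have [c hc] := hs v; exists c; split=> // d hd.
apply: funext => i; apply/eqP; rewrite -subr_eq0; apply/eqP.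
apply: (hi (fun i => c i - d i)).
have -> : \sum_i (c i - d i) *: e i =
    (v - \sum_i d i *: e i) - (v - \sum_i c i *: e i).
  rewrite opprB addrC addrA subrK -sumrB.
  by apply: eq_bigr => j _; rewrite scalerBl.
exact: subspaceB.
Qed.

Lemma indep_le W n k (e : 'I_n -> V) (e' : 'I_k -> V) :
  subspace W -> spans W e -> indep W e' -> (k <= n)%N.
Proof.
move=> hW hs hi; pose c i := sval (cid (hs (e' i))).
have cP i : W (e' i - \sum_j c i j *: e j) by rewrite /c; case: cid.
apply: (@free_rows_le _ _ (\matrix_(i, j) c i j)) => v vM.
apply/rowP => i; rewrite mxE; apply: (hi (fun i => v 0 i)).
have -> : \sum_i v 0 i *: e' i = \sum_i v 0 i *: (e' i - \sum_j c i j *: e j).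
  under [RHS]eq_bigr => i0 _ do rewrite scalerBr scaler_sumr.
  rewrite sumrB exchange_big /= [X in _ - X]big1 ?subr0 // => j _.
  under eq_bigr => i0 _ do rewrite scalerA.
  rewrite -scaler_suml; have /rowP/(_ j) := vM; rewrite !mxE.
  by under eq_bigr => i0 _ do rewrite mxE; move=> ->; rewrite scale0r.
by apply: subspace_sum => // i0 _; apply: subspaceZ.
Qed.

Definition has_codim W n := exists e : 'I_n -> V, quotient_basis W e.

Lemma fin_uniq W n m : subspace W -> has_codim W n -> has_codim W m -> n = m.
Proof.
move=> hW [e /(quotient_basisP _ hW) [i1 s1]] [e' /(quotient_basisP _ hW) [i2 s2]].
by apply/eqP; rewrite eqn_leq (indep_le hW s2 i1) (indep_le hW s1 i2).
Qed.

Lemma codim_fin W n : subspace W -> has_codim W n -> codim W = (n%:Z)%:E.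
Proof.
move=> hW hn; rewrite /codim.
have := xgetPex +oo%E (ex_intro (fun d => exists n, d = (n%:Z)%:E /\
   exists e : 'I_n -> V, quotient_basis W e) (n%:Z)%:E (ex_intro _ n (conj erefl hn))).
by case=> m [-> hm]; rewrite (fin_uniq hW hn hm).
Qed.

Lemma codim_nfin W : (forall n, ~ has_codim W n) -> codim W = +oo%E.
Proof. by move=> h; apply: xgetPN => d [n [_ hn]]; apply: h hn. Qed.

Variant codim_spec W : \bar int -> Prop :=
  | CodimFin n of has_codim W n : codim_spec W (n%:Z)%:E
  | CodimInf of (forall n, ~ has_codim W n) : codim_spec W +oo%E.

Lemma codimP W : subspace W -> codim_spec W (codim W).
Proof.
move=> hW; have [[n hn]|h] := pselect (exists n, has_codim W n).
  by rewrite (codim_fin hW hn); constructor.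
have {}h n : ~ has_codim W n by move=> hn; apply: h; exists n.
by rewrite codim_nfin //; constructor.
Qed.

(** An independent family of maximal length spans, since a vector outside its span could be
    prepended. *)
Lemma fin_of_bound W N : subspace W ->
  (forall k (e : 'I_k -> V), indep W e -> (k <= N)%N) ->
  exists n, (n <= N)%N /\ has_codim W n.
Proof.
move=> hW hN.
have h0 : exists k, `[< exists e : 'I_k -> V, indep W e >].
  exists 0%N; apply/asboolP; exists (fun _ => 0) => c _ [i hi]; by [].
have hb k : `[< exists e : 'I_k -> V, indep W e >] -> (k <= N)%N.
  by move=> /asboolP [e]; apply: hN.
case: (ex_maxnP h0 hb) => n /asboolP [e he] mx.
exists n; split; first by apply: hN he.
exists e; apply/quotient_basisP => //; split=> // v.
apply: contrapT => hv.
suff : (n.+1 <= n)%N by rewrite ltnn.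
apply: mx; apply/asboolP.
exists (fun i => if unlift ord0 i is Some j then e j else v) => c.
rewrite big_ord_recl unlift_none.
under eq_bigr => i _ do rewrite liftK.
move=> hc.
have c0 : c ord0 = 0.
  apply/eqP/negPn/negP => c0; apply: hv.
  exists (fun i => - (c ord0)^-1 * c (lift ord0 i)).
  have := subspaceZ (c ord0)^-1 hW hc.
  rewrite scalerDr scalerA mulVf // scale1r scaler_sumr -sumrN.
  congr (W (_ + _)); apply: eq_bigr => i _.
  by rewrite mulNr scaleNr opprK scalerA.
move: hc; rewrite c0 scale0r add0r => /he hc i.
by case: (unliftP ord0 i) => [j ->|->].
Qed.

Lemma codim_ge0 W : subspace W -> (0 <= codim W)%E.
Proof. by move=> hW; case: codimP => // n _; rewrite lee_fin. Qed.

Lemma codim_mono U W : subspace U -> subspace W -> (U `<=` W)%classic ->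
  (codim W <= codim U)%E.
Proof.
move=> hU hW UW; case: (codimP hU) => [n [e /(quotient_basisP _ hU) [_ hs]]|_];
  last by rewrite leey.
have [|m [le /(codim_fin hW) ->]] := @fin_of_bound W n hW; last by rewrite lee_fin lez_nat.
move=> k e'; apply: (indep_le (e := e) hW) => h.
by have [c hc] := hs h; exists c; apply: UW.
Qed.

Lemma codim_coord W n (phi : 'I_n -> V -> K) (e : 'I_n -> V) :
  (forall i, linear_for *%R (phi i)) ->
  (forall v, W v <-> forall i, phi i v = 0) ->
  (forall i j, phi i (e j) = (i == j)%:R) ->
  codim W = (n%:Z)%:E.
Proof.
move=> lin hW dual.
have phi0 i : phi i 0 = 0.
  have := lin i 1 0 0; rewrite scale1r addr0 mul1r => /eqP.
  by rewrite -subr_eq0 opprD addNKr oppr_eq0 => /eqP.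
have phiS i (c : 'I_n -> K) : phi i (\sum_j c j *: e j) = c i.
  have -> : phi i (\sum_j c j *: e j) = \sum_j c j * phi i (e j).
    elim/big_rec2: _ => [|j u v _ <-]; first exact: phi0.
    by rewrite lin.
  rewrite (bigD1 i) //= dual eqxx mulr1 big1 ?addr0 // => j ji.
  by rewrite dual eq_sym (negPf ji) mulr0.
have sW : subspace W.
  split; first by apply/hW => i.
  move=> a u v /hW hu /hW hv; apply/hW => i.
  by rewrite lin hu hv mulr0 addr0.
apply: codim_fin => //; exists e; apply/quotient_basisP => //; split.
  by move=> c /hW hc i; rewrite -(phiS i c).
move=> h; exists (fun i => phi i h); apply/hW => i.
by rewrite addrC -scaleN1r lin phiS mulN1r addNr.
Qed.

(** For finiteness alone the common kernel may be smaller than W, and no dual vectors have to be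
    given. *)
Lemma codim_coord_fin W n (phi : 'I_n -> V -> K) : subspace W ->
  (forall i, linear_for *%R (phi i)) ->
  (forall v, (forall i, phi i v = 0) -> W v) ->
  exists N : nat, codim W = (N%:Z)%:E.
Proof.
move=> sW lin hW.
have phi0 i : phi i 0 = 0.
  have := lin i 1 0 0; rewrite scale1r addr0 mul1r => /eqP.
  by rewrite -subr_eq0 opprD addNKr oppr_eq0 => /eqP.
have [|m [_ /(codim_fin sW) ->]] := @fin_of_bound W n sW; last by exists m.
move=> k e hi; apply: (@free_rows_le _ _ (\matrix_(i, j) phi j (e i))) => v vM.
apply/rowP => i; rewrite mxE; apply: (hi (fun i => v 0 i)).
apply: hW => j; have /rowP/(_ j) := vM; rewrite !mxE => e0; rewrite -[RHS]e0.
elim/big_rec2: _ => [|a u w _ <-]; first exact: phi0.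
by rewrite lin mxE.
Qed.

End OneSpace.

(* The exact sequence 0 -> V'/U' -> V/U -> V/W -> 0. *)
Lemma codim_ext (V V' : lmodType K) (lam : {linear V' -> V}) (U : set V)
    (W : set V) (U' : set V') :
  subspace U ->
  (forall v, W v <-> exists r u, U u /\ v = lam r + u) ->
  (forall r, U' r <-> U (lam r)) ->
  codim U = (codim W + codim U')%E.
Proof.
move=> hU hW hU'.
have UW u : U u -> W u by move=> uU; apply/hW; exists 0, u; rewrite linear0 add0r.
have sW : subspace W.
  split; first by apply/UW; exact: hU.1.
  move=> a u v /hW [r [x [xU ->]]] /hW [s [y [yU ->]]]; apply/hW.
  exists (a *: r + s), (a *: x + y); split; first exact: hU.2.
  by rewrite linearP scalerDr addrACA.
have sU' : subspace U'.
  split; first by apply/hU'; rewrite linear0; exact: hU.1.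
  by move=> a u v /hU' uU /hU' vU; apply/hU'; rewrite linearP; apply: hU.2.
have lamS n (c : 'I_n -> K) e : lam (\sum_i c i *: e i) = \sum_i c i *: lam (e i).
  by rewrite linear_sum; apply: eq_bigr => i _; rewrite linearZ.
have [a [aW|aN]] : exists a, has_codim W a \/ (forall n, ~ has_codim W n).
  by case: (codimP sW) => [n|]; [exists n; left | exists 0%N; right].
- have [b [bU|bN]] : exists b, has_codim U' b \/ (forall n, ~ has_codim U' n).
    by case: (codimP sU') => [n|]; [exists n; left | exists 0%N; right].
  + rewrite (codim_fin sW aW) (codim_fin sU' bU) -EFinD -PoszD.
    apply: codim_fin => //.
    have [e1 /(quotient_basisP _ sW) [i1 s1]] := aW.
    have [e2 /(quotient_basisP _ sU') [i2 s2]] := bU.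
    exists (fun i => match split i with inl j => e1 j | inr j => lam (e2 j) end).
    have sumE (c : 'I_(a + b) -> K) :
      \sum_i c i *: match split i with inl j => e1 j | inr j => lam (e2 j) end =
      \sum_i c (lshift b i) *: e1 i + lam (\sum_i c (rshift a i) *: e2 i).
      rewrite big_split_ord lamS /=; congr (_ + _); apply: eq_bigr => i _.
        by case: split_ordP => j /eqP; rewrite ?eq_lshift ?eq_lrshift // => /eqP ->.
      by case: split_ordP => j /eqP; rewrite ?eq_rshift ?eq_rlshift // => /eqP ->.
    apply/quotient_basisP => //; split.
      move=> c; rewrite sumE => hc.
      have c1 : forall i, c (lshift b i) = 0.
        apply: (i1 (fun i => c (lshift b i))).
        rewrite -[X in W X](addrK (lam (\sum_i c (rshift a i) *: e2 i))).
        apply: subspaceB => //; last by apply/hW; exists (\sum_i c (rshift a i) *: e2 i), 0;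
          rewrite addr0; split => //; exact: hU.1.
        exact: UW hc.
      move: hc; rewrite big1 ?add0r => [/hU'/i2 c2 i|i _]; last by rewrite c1 scale0r.
      by case: (split_ordP i) => j ->.
    move=> h; have [c /hW [r [u [uU e]]]] := s1 h.
    have [d /hU' hd] := s2 r.
    exists (fun i => match split i with inl j => c j | inr j => d j end).
    rewrite sumE opprD addrA.
    have -> : \sum_i match split (lshift b i) with
        | inl j => c j | inr j => d j end *: e1 i = \sum_i c i *: e1 i.
      apply: eq_bigr => i _; case: split_ordP => j /eqP;
        by rewrite ?eq_lshift ?eq_lrshift // => /eqP ->.
    have -> : \sum_i match split (rshift a i) with
        | inl j => c j | inr j => d j end *: e2 i = \sum_i d i *: e2 i.
      apply: eq_bigr => i _; case: split_ordP => j /eqP;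
        by rewrite ?eq_rshift ?eq_rlshift // => /eqP ->.
    rewrite e addrAC -linearB; exact: subspaceD.
  + rewrite (codim_nfin bN) (codim_fin sW aW) /=; apply: codim_nfin => n.
    move=> [e /(quotient_basisP _ hU) [_ hs]].
    have [|m [_ hm]] := @fin_of_bound _ U' n sU'; last exact: bN hm.
    move=> k e' hi; apply: (indep_le hU hs (e' := fun i => lam (e' i))) => c.
    by rewrite -lamS => /hU' /hi.
- have -> : codim U = +oo%E.
    apply: codim_nfin => n [e /(quotient_basisP _ hU) [_ hs]].
    have [|m [_ hm]] := @fin_of_bound _ W n sW; last exact: aN hm.
    move=> k e'; apply: (indep_le (e := e) sW) => h.
    by have [c hc] := hs h; exists c; apply: UW.
  rewrite (codim_nfin aN); have := codim_ge0 sU'.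
  by case: (codim U').
Qed.

Lemma eq_codim (V : lmodType K) (W U : set V) : (forall v, W v <-> U v) ->
  codim W = codim U.
Proof. by move=> h; congr codim; apply: funext => v; apply: propext. Qed.

End CodimensionTheory.

(** * Intersection multiplicity *)

Section Intersection.
Variable K : fieldType.
Implicit Types (f g h u : fps2 K) (Phi : {lrmorphism fps2 K -> fps2 K}).

Lemma mul_linear_exists (a : fps2 K) :
  exists lam : {linear fps2 K -> fps2 K}, forall r, lam r = a * r.
Proof.
have lin : linear (fun r : fps2 K => a * r).
  by move=> c u v; rewrite mulrDr -scalerAr.
pose lam : {linear fps2 K -> fps2 K} :=
  HB.pack (fun r : fps2 K => a * r)
    (GRing.isLinear.Build K (fps2 K) (fps2 K) _ _ lin).
by exists lam.
Qed.

Lemma ideal2_subspace f g : subspace (ideal2 f g).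
Proof.
split; first by exists 0, 0; rewrite !mul0r addr0.
move=> c u v [a [b ->]] [a' [b' ->]]; exists (c *: a + a'), (c *: b + b').
rewrite !mulrDl -!scalerAl scalerDr; ring.
Qed.

Lemma imult_ge0 f g : (0 <= imult f g)%E.
Proof. exact: codim_ge0 (ideal2_subspace f g). Qed.

Variant imult_spec f g : \bar int -> Prop :=
  | ImultFin n of imult f g = (n%:Z)%:E : imult_spec f g (n%:Z)%:E
  | ImultInf of imult f g = +oo%E : imult_spec f g +oo%E.

Lemma imultP f g : imult_spec f g (imult f g).
Proof.
case e : (imult f g) (imult_ge0 f g) => [[n|n]||] //= _; first exact: ImultFin.
exact: ImultInf.
Qed.

Lemma eq_imult f g f' g' : (forall h, ideal2 f g h <-> ideal2 f' g' h) ->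
  imult f g = imult f' g'.
Proof. exact: eq_codim. Qed.

Lemma imultC f g : imult f g = imult g f.
Proof.
by apply: eq_imult => h; split=> -[a [b ->]]; exists b, a; rewrite addrC.
Qed.

Lemma imultDM f g a : imult f (g + f * a) = imult f g.
Proof.
apply: eq_imult => h; split=> -[b [c ->]].
  by exists (b + c * a), c; ring.
by exists (b - c * a), c; ring.
Qed.

Lemma imult_unitMr f g u : u \is a GRing.unit -> imult f (u * g) = imult f g.
Proof.
move=> uu; apply: eq_imult => h; split=> -[b [c ->]].
  by exists b, (c * u); ring.
by exists b, (c * u^-1); rewrite -mulrA mulKr.
Qed.

Lemma codim_setT : codim (setT : set (fps2 K)) = 0%E.
Proof.
apply: (codim_coord (n := 0) (phi := fun _ _ => 0) (e := fun _ => 0)).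
- by case.
- by move=> v; split => // _ [].
- by case.
Qed.

Lemma imult_unit f u : u \is a GRing.unit -> imult f u = 0%E.
Proof.
move=> uu; rewrite -codim_setT; apply: eq_codim => h; split=> // _.
by exists 0, (h * u^-1); rewrite mul0r add0r divrK.
Qed.

(** This is [codim_ext] along Phi: surjectivity makes the quotient term vanish, and injectivity
    identifies the preimage of the ideal. *)
Lemma imult_hom Phi f g : bijective Phi -> imult (Phi f) (Phi g) = imult f g.
Proof.
move=> [Psi PsiK PhiK]; rewrite /imult.
have e := @codim_ext K _ _ Phi (ideal2 (Phi f) (Phi g)) setT (ideal2 f g).
rewrite e ?codim_setT ?add0e //.
- exact: ideal2_subspace.
- move=> v; split => // _; exists (Psi v), 0; split; first exact: (ideal2_subspace _ _).1.
  by rewrite addr0; apply/esym/PhiK.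
move=> r; split=> [[a [b ->]]|[a [b]]].
  by exists (Phi a), (Phi b); rewrite rmorphD !rmorphM.
rewrite -[a]PhiK -[b]PhiK -!rmorphM -rmorphD => /(can_inj PsiK) ->.
by exists (Psi a), (Psi b).
Qed.

Lemma imult_mono f g f' g' : (forall h, ideal2 f g h -> ideal2 f' g' h) ->
  (imult f' g' <= imult f g)%E.
Proof. by move=> h; apply: codim_mono => //; apply: ideal2_subspace. Qed.

Lemma codim_axis n :
  codim [set g : fps2 K | forall i : 'I_n, coef2 g i 0 = 0] = (n%:Z)%:E.
Proof.
apply: (codim_coord (phi := fun (i : 'I_n) (g : fps2 K) => coef2 g i 0)
          (e := fun i => fpsX ^+ i * fpsY ^+ 0)) => //.
by move=> i j; rewrite coef2_monomial eqxx andbT.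
Qed.

(** Modulo y, f is x^n times a unit, so f and y generate the ideal of x^n and y, whose colength is
    [codim_axis]. *)
Lemma imult_Y f n : (forall i, (i < n)%N -> coef2 f i 0 = 0) ->
  coef2 f n 0 <> 0 -> imult f fpsY = (n%:Z)%:E.
Proof.
move=> f0 fn; rewrite -codim_axis; apply: eq_codim => g; split=> [[a [b ->]] i|g0].
  rewrite coef2D [b * _]mulrC coef2YM addr0 coef2M big1 // => k _.
  rewrite big_ord1 [X in _ * X]f0 ?mulr0 //.
  by apply: leq_ltn_trans (ltn_ord i); apply: leq_subr.
pose ax (h : fps2 K) := Fps2 (fun i j => if j is 0%N then coef2 h i 0 else 0).
have axE h : exists r, h = ax h + fpsY * r.
  exists (Fps2 (fun i j => coef2 h i j.+1)); apply: fps2P => i j.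
  by rewrite coef2D coef2YM; case: j => [|j] /=; rewrite ?addr0 ?add0r.
have div h : (forall i, (i < n)%N -> coef2 h i 0 = 0) ->
    exists q, ax h = fpsX ^+ n * q.
  by move=> h0; apply: divXn => i [|j] lt //=; apply: h0.
have [q fq] := div f f0; have [r fr] := axE f.
have [q' gq] : exists q, ax g = fpsX ^+ n * q.
  by apply: div => i lt; apply: (g0 (Ordinal lt)).
have [r' gr] := axE g.
have qu : q \is a GRing.unit.
  rewrite fps2_unitE; apply/eqP => q0; apply: fn.
  by have := congr1 (fun h => coef2 h n 0) fq; rewrite coef2XnM leqnn subnn q0.
exists (q' * q^-1), (r' - q' * q^-1 * r).
rewrite gr fr gq fq.
have -> : fpsX ^+ n * q' = fpsX ^+ n * q * (q' * q^-1).
  by rewrite -mulrA [q' * _]mulrC mulVKr.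
ring.
Qed.

Lemma imult_Y_inf f : (forall i, coef2 f i 0 = 0) -> imult f fpsY = +oo%E.
Proof.
move=> f0; case: imultP => // n e.
suff : ((n.+1%:Z)%:E <= (n%:Z)%:E :> \bar int)%E by rewrite lee_fin lez_nat ltnn.
rewrite -e -(codim_axis n.+1); apply: codim_mono.
- exact: ideal2_subspace.
- split=> [i //|c u v hu hv i]; first by rewrite coef2D coef2Z hu hv mulr0 addr0.
move=> _ [a [b ->]] i.
rewrite coef2D [b * _]mulrC coef2YM addr0 coef2M big1 // => k _.
by rewrite big_ord1 [X in _ * X]f0 mulr0.
Qed.

Variant axis_spec f : Prop :=
  | AxisFin n of (forall i, (i < n)%N -> coef2 f i 0 = 0) & coef2 f n 0 <> 0
      & imult f fpsY = (n%:Z)%:E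
  | AxisInf of (forall i, coef2 f i 0 = 0) & imult f fpsY = +oo%E.

Lemma axisP f : axis_spec f.
Proof.
have [h|h] := pselect (forall i, coef2 f i 0 = 0).
  by apply: AxisInf => //; apply: imult_Y_inf.
have [n hn] : exists n, coef2 f n 0 != 0.
  by apply: contrapT => c; apply: h => i; apply/eqP/negPn/negP => ?; apply: c; exists i.
have : exists n, coef2 f n 0 != 0 by exists n.
case/ex_minnP => {hn}n /eqP hn mn.
have f0 i : (i < n)%N -> coef2 f i 0 = 0.
  by move=> lt; apply/eqP/negPn/negP => /mn; rewrite leqNgt lt.
by apply: (AxisFin (n := n)) => //; apply: imult_Y.
Qed.

Lemma imult_Y_ge f n m : imult f fpsY = (n%:Z)%:E ->
  (forall i, (i < m)%N -> coef2 f i 0 = 0) -> (m <= n)%N.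
Proof.
move=> e fm; case: (axisP f) => [k _ fk|_]; rewrite e // => -[->].
by rewrite leqNgt; apply/negP => /fm.
Qed.

(** Exchanging the coordinates transfers statements about [fpsY] to [fpsX]. *)
Lemma swap_exists : exists sw : {lrmorphism fps2 K -> fps2 K},
  [/\ involutive sw, sw fpsX = fpsY, sw fpsY = fpsX &
      forall f i j, coef2 (sw f) i j = coef2 f j i].
Proof.
have [sw [swX swY]] := subst_exists (@inmY K) (@inmX K).
have swC f i j : coef2 (sw f) i j = coef2 f j i.
  have := hom_ev sw (N := (i + j).+1) f => /(_ i j).
  rewrite mul1n coef2B => /(_ (ltnSn _)) /eqP; rewrite subr_eq0 => /eqP ->.
  rewrite swX swY /ev coef2_sum.
  have li : (i < (i + j).+1)%N by lia.
  have lj : (j < (i + j).+1)%N by lia.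
  rewrite (bigD1 (Ordinal lj, Ordinal li)) // coef2Z mulrC [_ ^+ _ * _]mulrC.
  rewrite coef2_monomial !eqxx mul1r big1; first by rewrite /= addr0.
  move=> -[p q]; rewrite coef2Z [_ ^+ _ * _]mulrC coef2_monomial /=.
  case: andP => [[/eqP e1 /eqP e2]|_ _]; last by rewrite mulr0.
  by case/eqP; congr pair; apply: val_inj.
exists sw; split=> // f; apply: fps2P => i j; rewrite !swC //.
Qed.

Lemma imult_X f n : (forall j, (j < n)%N -> coef2 f 0 j = 0) ->
  coef2 f 0 n <> 0 -> imult f fpsX = (n%:Z)%:E.
Proof.
have [sw [swK swX swY swC]] := swap_exists.
move=> f0 fn; rewrite -(imult_hom f fpsX (inv_bij swK)) swX.
by apply: imult_Y => [i|]; rewrite swC //; apply: f0.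
Qed.

Lemma imult_X_ge f n m : imult f fpsX = (n%:Z)%:E ->
  (forall i, (i < m)%N -> coef2 f 0 i = 0) -> (m <= n)%N.
Proof.
have [sw [swK swX swY swC]] := swap_exists.
rewrite -(imult_hom f fpsX (inv_bij swK)) swX => /imult_Y_ge h fm.
by apply: h => i lt; rewrite swC fm.
Qed.

(* In terms of a parametrization of the curve f = 0, imult f g is the order of
   g(t) and jac f g restricts to c(t) g'(t) with c independent of g; br_jac
   combines ord h' >= ord h - 1 with the equality ord g' = ord g - 1, valid when
   ord g is nonzero in K. *)
Record branch f : Prop := Branch {
  br_inf : forall g, imult f g = +oo%E <-> divides f g;
  br_mul : forall g h, imult f (g * h) = (imult f g + imult f h)%E;
  br_add : forall g h, (Order.min (imult f g) (imult f h) <= imult f (g + h)%R)%E;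
  br_jac : forall g h n, imult f g = (n%:Z)%:E -> n%:R != 0 :> K ->
    (imult f (jac f g) + imult f h <= imult f (jac f h) + imult f g)%E }.

Lemma branch_prime f g h : branch f -> divides f (g * h) ->
  divides f g \/ divides f h.
Proof.
move=> fb /(br_inf fb); rewrite (br_mul fb).
case: (imultP f g) => [n e1|/(br_inf fb)]; last by left.
case: (imultP f h) => [m e2|/(br_inf fb)]; last by right.
by [].
Qed.

(** The value of g is the order of g(x, 0), and [jac fpsY g] is -g_x. Differentiation lowers the
    order n by at most one, and by exactly one if n is nonzero in K. *)
Lemma branch_Y : branch (fpsY : fps2 K).
Proof.
split.
- move=> g; rewrite imultC; split=> [|[h ->]].
    case: (axisP g) => [n _ _ -> //|g0 _ _].
    have [h ->] : exists h, g = fpsY ^+ 1 * h.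
      by apply: divYn => i [|j] // _; apply: g0.
    by exists h; rewrite expr1 mulrC.
  by apply: imult_Y_inf => i; rewrite mulrC coef2YM.
- move=> g h; rewrite !(imultC fpsY).
  have coefM0 i : coef2 (g * h) i 0 = \sum_(a < i.+1) coef2 g a 0 * coef2 h (i - a)%N 0.
    by rewrite coef2M; apply: eq_bigr => a _; rewrite big_ord1.
  case: (axisP g) => [n g0 gn ->|g0 ->]; last first.
    rewrite imult_Y_inf; first by have := imult_ge0 h fpsY; case: imult.
    by move=> i; rewrite coefM0 big1 // => a _; rewrite g0 mul0r.
  case: (axisP h) => [m h0 hm ->|h0 ->]; last first.
    rewrite imult_Y_inf //.
    by move=> i; rewrite coefM0 big1 // => a _; rewrite h0 mulr0.
  rewrite -EFinD -PoszD; apply: imult_Y => [i lt|].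
    rewrite coefM0 big1 // => a _; have [an|na] := ltnP a n.
      by rewrite g0 ?mul0r.
    by rewrite h0 ?mulr0 //; have := ltn_ord a; lia.
  have lt : (n < (n + m).+1)%N by lia.
  rewrite coefM0 (bigD1 (Ordinal lt)) //= addKn big1 ?addr0.
    by move=> /eqP; rewrite mulf_eq0 => /orP [] /eqP.
  move=> [a la] /eqP ne /=; have {}ne : a <> n.
    by move=> e; apply: ne; apply: val_inj.
  have [an|na] := ltnP a n; first by rewrite g0 ?mul0r.
  by rewrite [X in _ * X]h0 ?mulr0 //; lia.
- move=> g h; rewrite !(imultC fpsY).
  case: (axisP (g + h)) => [n _ ghn ->|_ ->]; last exact: leey.
  rewrite leNgt; apply/negP; rewrite lt_min => /andP [ltg lth].
  apply: ghn; rewrite coef2D.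
  case: (axisP g) ltg => [m g0 _ ->|-> _ _]; [rewrite lte_fin ltz_nat => /g0 ->|];
  by case: (axisP h) lth => [l h0 _ ->|-> _ _]; [rewrite lte_fin ltz_nat => /h0 ->|];
    rewrite addr0.
- move=> g h n; rewrite !(imultC fpsY).
  have jY k : jac fpsY k = - fps2_dx k by rewrite jacE dxY dyY; ring.
  rewrite !jY => e n0.
  have n1 : (0 < n)%N by rewrite lt0n; apply: contraNneq n0 => ->; rewrite mulr0n.
  have [g0 gn] : (forall i, (i < n)%N -> coef2 g i 0 = 0) /\ coef2 g n 0 <> 0.
    by case: (axisP g) => [m g0 gm|_]; rewrite e // => -[->].
  rewrite e (@imult_Y (- fps2_dx g) n.-1); first last.
  - rewrite coef2N /= prednK // => /eqP.
    by rewrite oppr_eq0 -mulr_natr mulf_eq0 (negPf n0) orbF => /eqP.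
  - by move=> i lt; rewrite coef2N /= g0 ?mul0rn ?oppr0 //; lia.
  case: (axisP h) => [m h0 hm ->|h0 ->]; last first.
    by rewrite [X in (_ <= X + _)%E]imult_Y_inf // => i; rewrite coef2N /= h0 mul0rn oppr0.
  case: (axisP (- fps2_dx h)) => [k _ hk ->|_ ->]; last by rewrite leey.
  rewrite -!EFinD lee_fin; suff : (m <= k.+1)%N by lia.
  rewrite leqNgt; apply/negP => lt; apply: hk.
  by rewrite coef2N /= h0 ?mul0rn ?oppr0.
Qed.

(** Cancellation for the Jacobian property in [branch_pull]: j is the value of the Jacobian
    determinant and must be finite. If e is infinite, so are a and c. *)
Lemma ereal_cancel (j n : nat) (a b c d e v : \bar int) :
  (0 <= a -> 0 <= b -> 0 <= c -> 0 <= d -> 0 <= e -> 0 <= v ->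
  j%:Z%:E + a = e + b -> j%:Z%:E + c = e + d ->
  b + v <= d + n%:Z%:E -> a + v <= c + n%:Z%:E)%E.
Proof.
move: a b c d e v => [a||] [b||] [c||] [d||] [e||] [v||] //=;
  rewrite ?leey -?EFinD ?lee_fin // => _ _ _ _ _ _ [h1] [h2] h3; lia.
Qed.

Lemma imultE f g : imult f g = codim (ideal2 f g).
Proof. by []. Qed.

Opaque imult.

(* Multiplication by Phi g on B = R/f1 and on its subring A = R/f of finite
   colength N have cokernels of the same length, both being compared to
   B / Phi g A; hence imult f g = imult f1 (Phi g). *)
Lemma branch_pull Phi f f1 (e : fps2 K) (N : nat) : branch f1 ->
  (forall g, divides f1 (Phi g) <-> divides f g) ->
  codim [set v | exists r t : fps2 K, v = Phi r + t * f1] = (N%:Z)%:E ->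
  Phi f = e * f1 -> ~ divides f1 (jac (Phi fpsX) (Phi fpsY)) ->
  branch f.
Proof.
move=> b1 dv hN fe jnz.
move: hN; set U0 := (X in codim X) => hN.
have [lp lpE] : exists l : {linear fps2 K -> fps2 K}, forall r, l r = Phi r.
  by exists Phi.
have valE g : imult f g = imult f1 (Phi g).
  have [dg|ndg] := pselect (divides f g).
    have e1 : imult f1 (Phi g) = +oo%E by apply/(br_inf b1)/dv.
    rewrite e1; have [q gq] := dg.
    have := @codim_ext K _ _ lp (ideal2 f1 (Phi g)) U0 (ideal2 f g).
    rewrite -!imultE e1 hN => h.
    suff : +oo%E = ((N%:Z)%:E + imult f g)%E by case: imultP.
    have [k gk] := (dv g).2 dg.
    apply: h; first exact: ideal2_subspace.
      move=> v; split=> [[r [t ->]]|[r [_ [[a [b ->]] ->]]]].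
        by exists r, (t * f1); rewrite lpE; split=> //; exists t, 0; ring.
      by exists r, (a + b * k); rewrite lpE gk; ring.
    move=> r; rewrite lpE; split=> [[a [b ->]]|[a [b rab]]].
      by exists (Phi a * e), (Phi b); rewrite rmorphD !rmorphM /= fe; ring.
    have [c ->] : divides f r.
      by apply/dv; exists (a + b * k); rewrite rab gk; ring.
    by exists c, 0; ring.
  have [lam lamE] := mul_linear_exists (Phi g).
  (* The image of Phi g A in B. It is reached from the ideal of f1 and Phi g in [h1], and from the
     image [U0] of A in [h2]. *)
  pose U2 : set (fps2 K) := fun v => exists s t : fps2 K, v = Phi g * Phi s + t * f1.
  have sU2 : subspace U2.
    split; first by exists 0, 0; rewrite rmorph0 mulr0 mul0r addr0.
    move=> c _ _ [s [t ->]] [s' [t' ->]]; exists (c *: s + s'), (c *: t + t').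
    rewrite linearP scalerDr mulrDr mulrDl -!scalerAr -!scalerAl; ring.
  have h1 : codim U2 = (imult f1 (Phi g) + codim U0)%E.
    rewrite imultE; apply: (codim_ext (lam := lam)) => //.
      move=> v; split=> [[a [b ->]]|[r [_ [[s [t ->]] ->]]]].
        exists b, (a * f1); rewrite lamE; split; last by ring.
        by exists 0, a; rewrite rmorph0 mulr0 add0r.
      by exists t, (r + Phi s); rewrite lamE; ring.
    move=> r; rewrite /U0 /U2 /= lamE; split=> [[s [t ->]]|[s [t hr]]].
      by exists s, (Phi g * t); ring.
    have : divides f1 (Phi g * (r - Phi s)).
      by exists t; rewrite mulrBr hr; ring.
    case/(branch_prime b1) => [/dv //|[k hk]].
    by exists s, k; rewrite -hk; ring.
  have h2 : codim U2 = (codim U0 + imult f g)%E.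
    rewrite imultE; apply: (codim_ext (lam := lp)) => //.
      move=> v; split=> [[r [t ->]]|[r [_ [[s [t ->]] ->]]]].
        exists r, (t * f1); rewrite lpE; split => //.
        by exists 0, t; rewrite rmorph0 mulr0 add0r.
      by exists (r + g * s), t; rewrite lpE rmorphD rmorphM; ring.
    move=> r; rewrite lpE; split=> [[a [b ->]]|[s [t hr]]].
      by exists b, (Phi a * e); rewrite rmorphD !rmorphM /= fe; ring.
    have [c hc] : divides f (r - g * s).
      by apply/dv; exists t; rewrite rmorphB rmorphM /= hr; ring.
    by exists c, s; rewrite [s * g]mulrC -hc; ring.
  move: h2; rewrite h1 hN.
  case: imultP => [a|] _; case: imultP => [b|] _ //.
  by rewrite -!EFinD => -[] ?; congr (Posz _)%:E; lia.
have nd x : ~ divides f1 x -> exists n : nat, imult f1 x = (n%:Z)%:E.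
  by move=> h; case: (imultP f1 x) => [n _|/(br_inf b1)//]; exists n.
(* Since Phi f = e f1, the Jacobian of Phi f and Phi h is e times that of f1 and Phi h modulo f1. *)
have jE h : (imult f1 (jac (Phi fpsX) (Phi fpsY)) + imult f (jac f h) =
    imult f1 e + imult f1 (jac f1 (Phi h)))%E.
  apply: etrans (congr1 (adde _) (valE (jac f h))) _.
  apply: etrans (esym (br_mul b1 _ _)) _.
  apply: etrans _ (br_mul b1 e (jac f1 (Phi h))).
  rewrite -(jac_hom Phi f h) fe (jacM e f1); exact: imultDM.
split.
- by move=> g; rewrite valE; split=> [/(br_inf b1)/dv|/dv/(br_inf b1)].
- move=> g h; rewrite (valE g) (valE h) (valE (g * h)) (rmorphM Phi g h).
  exact: br_mul.
- move=> g h; rewrite (valE g) (valE h) (valE (g + h)) (rmorphD Phi g h).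
  exact: br_add.
move=> g h n gn n0; have := br_jac b1 (Phi h) (etrans (esym (valE g)) gn) n0.
rewrite -(valE g) -(valE h) gn.
have [j ej] := nd _ jnz.
move: (jE g) (jE h); rewrite ej.
by apply: ereal_cancel; apply: imult_ge0.
Qed.

End Intersection.

(** * Weierstrass preparation and blowing up *)

Section Weierstrass.
Variable K : fieldType.
Implicit Types (f g h u P Q U : fps2 K).

Definition yreg m f := (forall j, (j < m)%N -> coef2 f 0 j = 0) /\ coef2 f 0 m <> 0.

Definition ydeg_lt m f := forall i j, (m <= j)%N -> coef2 f i j = 0.

(** Weierstrass polynomials in y: P(0, y) = y^m, and P is monic of degree m. *)
Definition wpoly m P := [/\ forall j, coef2 P 0 j = (j == m)%:R,
  forall i, coef2 P i m = (i == 0%N)%:R & ydeg_lt m.+1 P].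

Definition xord k f := forall i j, (i < k)%N -> coef2 f i j = 0.

Definition yhigh m f := Fps2 (fun i j => coef2 f i (j + m)%N).
Definition ylow m f := Fps2 (fun i j => if (j < m)%N then coef2 f i j else 0).

Lemma ylow_high m f : f = fpsY ^+ m * yhigh m f + ylow m f.
Proof.
apply: fps2P => i j; rewrite coef2D coef2YnM /=.
by case: leqP => [le|lt]; rewrite ?subnK ?addr0 ?add0r.
Qed.

(** Banach's fixed point theorem for the x-adic topology: the coefficients of x^i are constant from
    the iterate [i.+1] on. *)
Lemma xord_fix (M : fps2 K -> fps2 K) G :
  (forall a b, M (a - b) = M a - M b) ->
  (forall k a, xord k a -> xord k.+1 (M a)) ->
  exists q, q = G + M q.
Proof.
move=> MB Mx; pose S n := iter n (fun a => G + M a) 0.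
have Sx n k : xord n (S (n + k)%N - S n).
  elim: n => [|n IH] i j lt //; rewrite addSn /S !iterS -!/(S _).
  rewrite opprD addrACA subrr add0r -MB; exact: Mx IH _ _ lt.
pose q := Fps2 (fun i j => coef2 (S i.+1) i j).
have qS n : xord n (q - S n).
  move=> i j lt; have := Sx i.+1 (n - i.+1)%N i j (ltnSn i).
  by rewrite subnKC // !coef2B /= => /eqP; rewrite subr_eq0 => /eqP ->; rewrite subrr.
exists q; apply: fps2P => i j; apply/eqP; rewrite -subr_eq0 -coef2B; apply/eqP.
have -> : q - (G + M q) = (q - S i.+2) - M (q - S i.+1).
  by rewrite MB [S i.+2]iterS -/(S i.+1); ring.
by rewrite coef2B (qS i.+2) ?(Mx _ _ (qS i.+1)) ?subrr //; lia.
Qed.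

Lemma xordM k l f g : xord k f -> xord l g -> xord (k + l) (f * g).
Proof.
move=> hf hg i j lt; rewrite coef2M big1 // => a _; rewrite big1 // => b _.
have [ak|ka] := ltnP a k; first by rewrite hf ?mul0r.
by rewrite [X in _ * X]hg ?mulr0 //; have := ltn_ord a; lia.
Qed.

(* The quotient is the fixed point of an x-adic contraction. *)
Lemma weierstrass_division m f g : yreg m f ->
  exists q r, g = q * f + r /\ ydeg_lt m r.
Proof.
move=> [f0 fm]; pose u := yhigh m f.
have uu : u \is a GRing.unit by rewrite fps2_unitE /= add0n; apply/eqP.
pose T := ylow m f * u^-1.
have Tx : xord 1 T.
  rewrite -[1%N]addn0; apply: xordM => // -[|i] j // _ /=.
  by case: ifP => // /f0.
(* For the quotient q u^-1 one has q u^-1 f = q y^m + q T, and this equation compares the terms of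
   degree at least m in y. It is contracting because x divides T. *)
have [q qE] : exists q, q = yhigh m g + - yhigh m (q * T).
  apply: xord_fix => [a b|k a hk i j lt].
    by apply: fps2P => i j; rewrite mulrBl /=; ring.
  rewrite coef2N /= -[RHS]oppr0; congr (- _).
  by have := xordM hk Tx; rewrite addn1; apply.
exists (q * u^-1), (ylow m g - ylow m (q * T)); split; last first.
  by move=> i j le; rewrite coef2B /= ltnNge le subr0.
have e1 : q * T = fpsY ^+ m * yhigh m (q * T) + ylow m (q * T) by exact: ylow_high.
have gE : g = fpsY ^+ m * (q + yhigh m (q * T)) + ylow m g.
  by rewrite {1}qE subrK; exact: ylow_high.
have -> : q * u^-1 * f = q * fpsY ^+ m + q * T.
  rewrite [X in _ * X](ylow_high m f) -/u mulrDr /T mulrA [ylow m f * _]mulrC.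
  by rewrite -[q / u * _ * u]mulrA [fpsY ^+ m * u]mulrC mulrA divrK // mulrA.
by rewrite {1}gE {2}e1; ring.
Qed.

Lemma wpoly_yreg m P : wpoly m P -> yreg m P.
Proof.
move=> [h _ _]; split=> [j lt|]; rewrite h; first by rewrite ltn_eqF.
by rewrite eqxx; apply/eqP/oner_neq0.
Qed.

(** By induction on i, the coefficient of x^i y^(j+k) in Q U reduces to that of x^i y^j in U,
    because Q(0, y) = y^k. For n = 0 this is the uniqueness of Weierstrass division. *)
Lemma wpoly_ydeg k n Q U : wpoly k Q -> ydeg_lt (n + k) (Q * U) -> ydeg_lt n U.
Proof.
move=> [Q0 Qk Qd] hQU i; elim/ltn_ind: i => i IH j nj.
have := hQU i (j + k)%N ltac:(lia); rewrite coef2M big_ord_recl /=.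
have lt : (k < (j + k).+1)%N by lia.
rewrite (bigD1 (Ordinal lt)) // Q0 eqxx mul1r subn0 addnK.
rewrite big1 ?addr0; last first.
  move=> b /eqP nb; rewrite Q0; case: eqP => [e|]; last by rewrite mul0r.
  by case: nb; apply: val_inj.
rewrite /= addr0 big1 ?addr0 // => a _; rewrite big1 // => b _.
have [bk|kb] := leqP b k; last by rewrite Qd ?mul0r.
rewrite [X in _ * X]IH ?mulr0 //; last by lia.
by rewrite /bump /=; have := ltn_ord a; lia.
Qed.

Lemma coef2_yreg_mul m f g : (forall j, (j < m)%N -> coef2 f 0 j = 0) ->
  (forall j, (j < m)%N -> coef2 (f * g) 0 j = 0) /\
  coef2 (f * g) 0 m = coef2 f 0 m * coef2 g 0 0.
Proof.
move=> f0; split=> [j lt|]; rewrite coef2M big_ord1.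
  by rewrite big1 // => b _; rewrite f0 ?mul0r //; have := ltn_ord b; lia.
by rewrite big_ord_recr /= !subnn big1 ?add0r // => b _; rewrite f0 ?mul0r.
Qed.

(** Divide y^m by f: on x = 0 the remainder vanishes and the quotient has nonzero constant term. *)
Lemma weierstrass_preparation m f : yreg m f ->
  exists u P, [/\ u \is a GRing.unit, wpoly m P & P = u * f].
Proof.
move=> hf; have [q [r [e hr]]] := weierstrass_division (fpsY ^+ m) hf.
exists q, (fpsY ^+ m - r).
have PE : fpsY ^+ m - r = q * f by rewrite e addrK.
have Ycoef i j : coef2 (fpsY ^+ m : fps2 K) i j = ((i == 0%N) && (j == m))%:R.
  by rewrite -[fpsY ^+ m]mul1r -(expr0 fpsX) coef2_monomial.
have [l0 lm] := coef2_yreg_mul q hf.1.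
have qu : q \is a GRing.unit.
  rewrite fps2_unitE; apply/eqP => q0; move: lm; rewrite q0 mulr0 mulrC -PE.
  by rewrite coef2B Ycoef !eqxx hr // subr0 => /eqP; rewrite oner_eq0.
split=> //; split=> [j|i|i j lt].
- have [lt|ge] := ltnP j m; last by rewrite coef2B Ycoef /= hr ?subr0.
  by rewrite PE mulrC l0 // ltn_eqF.
- by rewrite coef2B Ycoef hr // subr0 eqxx andbT.
by rewrite coef2B Ycoef hr 1?ltnW // subr0 (gtn_eqF lt) andbF.
Qed.

Lemma yreg_exists f j0 : coef2 f 0 j0 <> 0 -> exists m, (m <= j0)%N /\ yreg m f.
Proof.
move=> /eqP h; have : exists j, coef2 f 0 j != 0 by exists j0.
case/ex_minnP => m /eqP hm mn; exists m; split; first exact: mn.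
by split=> // j lt; apply/eqP/negPn/negP => /mn; rewrite leqNgt lt.
Qed.

Lemma blowup_exists : exists bl : {lrmorphism fps2 K -> fps2 K},
  [/\ bl fpsX = fpsX, bl fpsY = fpsX * fpsY &
      forall f i j, coef2 (bl f) i j = if (j <= i)%N then coef2 f (i - j) j else 0].
Proof.
have [|bl [blX blY]] := subst_exists (@inmX K) (b := fpsX * fpsY).
  by apply: wtMr; exact: inmX.
exists bl; split=> // f i j.
have := hom_ev bl (N := (i + j).+1) f => /(_ i j).
rewrite mul1n coef2B => /(_ (ltnSn _)) /eqP; rewrite subr_eq0 => /eqP ->.
rewrite blX blY /ev coef2_sum.
have mE (p q : nat) : fpsX ^+ p * (fpsX * fpsY) ^+ q = fpsX ^+ (p + q) * fpsY ^+ q :> fps2 K.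
  by rewrite exprMn exprD mulrA.
case: leqP => [ji|ij]; last first.
  rewrite big1 // => -[p q] _; rewrite coef2Z mE coef2_monomial /=.
  case: andP => [[/eqP e1 /eqP e2]|_]; last by rewrite mulr0.
  by lia.
have l1 : (i - j < (i + j).+1)%N by lia.
have l2 : (j < (i + j).+1)%N by lia.
rewrite (bigD1 (Ordinal l1, Ordinal l2)) // big1; last first.
  move=> -[p q]; rewrite coef2Z mE coef2_monomial /=.
  case: andP => [[/eqP e1 /eqP e2]|_ _]; last by rewrite mulr0.
  by case/eqP; congr pair; apply: val_inj => /=; lia.
by rewrite coef2Z mE coef2_monomial /= subnK // !eqxx mulr1 addr0.
Qed.

(** * The strict transform of an irreducible Weierstrass polynomial *)

Section BlowUp.
Variable bl : {lrmorphism fps2 K -> fps2 K}.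
Hypotheses (blX : bl fpsX = fpsX) (blY : bl fpsY = fpsX * fpsY).
Hypothesis blE : forall f i j,
  coef2 (bl f) i j = if (j <= i)%N then coef2 f (i - j) j else 0.

Lemma bl_inj : injective bl.
Proof.
move=> f g e; apply: fps2P => i j; have := congr1 (fun k => coef2 k (i + j) j) e.
by rewrite !blE leq_addl addnK.
Qed.

(* x^k g(x, y/x), a power series as soon as g has degree at most k in y. *)
Definition homog k g := Fps2 (fun i j =>
  if (j <= k <= i + j)%N then coef2 g (i + j - k) j else 0).

Lemma bl_homog k g : ydeg_lt k.+1 g -> bl (homog k g) = fpsX ^+ k * g.
Proof.
move=> hg; apply: fps2P => i j; rewrite blE coef2XnM /=.
have [ki|ik] := leqP k i; last first.
  by case: (leqP j i) => // ji; rewrite subnK // [(k <= i)%N]leqNgt ik andbF.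
have [jk|kj] := leqP j k; last by rewrite [RHS]hg //= if_same.
by rewrite ifT ?subnK ?ki //; lia.
Qed.

(** This is f(x, x y) / x^m if f has order at least m and degree at most m in y. *)
Definition strict_transform m f := Fps2 (fun i j => if (j <= m)%N then coef2 f (i + m - j) j else 0).

Lemma bl_strict m P : inm m P -> ydeg_lt m.+1 P -> bl P = fpsX ^+ m * strict_transform m P.
Proof.
move=> hP dP; apply: fps2P => i j; rewrite blE coef2XnM /=.
have [mi|im] := leqP m i; last first.
  by case: leqP => // ji; rewrite hP //; lia.
have [jm|mj] := leqP j m; last by rewrite [RHS]/= dP // if_same.
by rewrite ifT ?subnK //; lia.
Qed.

Lemma strict_ydeg m P : ydeg_lt m.+1 (strict_transform m P).
Proof. by move=> i j lt /=; rewrite leqNgt lt. Qed.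

Variables (m : nat) (P : fps2 K).
Hypotheses (Pm : (0 < m)%N) (Pinm : inm m P) (Pw : wpoly m P).
Hypotheses (Pm0 : coef2 P m 0 = 0) (Pirr : irreducible P).
Let P1 := strict_transform m P.

Let blP : bl P = fpsX ^+ m * P1.
Proof. by apply: bl_strict => //; case: Pw. Qed.

Let P1m i : coef2 P1 i m = (i == 0%N)%:R.
Proof. by case: Pw => _ h _; rewrite /= leqnn addnK h. Qed.

(* A Weierstrass factor of the strict transform scales back to a factor of P. *)
Lemma strict_factor k Q U : wpoly k Q -> P1 = Q * U -> k = 0%N \/ k = m.
Proof.
move=> Qw e; have [Pw0 Pwm Pwd] := Pw; have [Q0 Qk Qd] := Qw.
have km : (k <= m)%N.
  rewrite leqNgt; apply/negP => lt.
  have := P1m 0; rewrite e (coef2_yreg_mul U (wpoly_yreg Qw).1).1 //.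
  by move/eqP; rewrite eq_sym oner_eq0.
have Ud : ydeg_lt (m - k).+1 U.
  by apply: (wpoly_ydeg Qw); rewrite -e addSn subnK //; apply: strict_ydeg.
have PE : P = homog k Q * homog (m - k) U.
  apply: bl_inj; rewrite rmorphM /= !bl_homog // (bl_strict Pinm Pwd) -/P1 e.
  by rewrite -[in LHS](subnKC km) exprD; ring.
(* A series [homog k Q] has zero constant term unless k = 0, so irreducibility of P forces k = 0 or
   m - k = 0. *)
have [_ _ /(_ _ _ PE)] := Pirr; rewrite !fps2_unitE /= !addn0.
case=> hu; [left|right].
  by move: hu; case: (k) => // k'; rewrite eqxx.
by move: hu; case E: (m - k)%N => [|n]; [lia | rewrite eqxx].
Qed.

(** An irreducible series has only one tangent. If P1(0, y) has order k at y = 0, the Weierstrass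
    polynomial of P1 divides P1, so k is 0 or m by [strict_factor]; [Pm0] excludes 0. *)
Lemma strict_wpoly : wpoly m P1.
Proof.
have P10 : coef2 P1 0 m <> 0 by rewrite P1m; apply/eqP/oner_neq0.
have [k [km hk]] := yreg_exists P10.
have k0 : k <> 0%N.
  by move=> k0; case: hk; rewrite k0 /= add0n subn0 Pm0.
have [u [Q [uu Qw QE]]] := weierstrass_preparation hk.
have [//|{}km] : k = 0%N \/ k = m.
  by apply: (strict_factor (U := u^-1) Qw); rewrite QE mulrC mulKr.
move: hk; rewrite km => hk.
split=> [j||]; [|exact: P1m|exact: (@strict_ydeg m P)].
have [lt|] := ltnP j m; first by rewrite hk.1 // ltn_eqF.
rewrite leq_eqVlt => /orP [/eqP <-|lt]; first by rewrite P1m !eqxx.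
by rewrite (@strict_ydeg m P) // gtn_eqF.
Qed.

Lemma strict_nonunit : P1 \isn't a GRing.unit.
Proof. by rewrite fps2_unitE /= add0n subn0 Pm0 eqxx. Qed.

(** A nonunit factor g is regular in y of some order k > 0. Its Weierstrass polynomial divides P1,
    so k = m, which leaves no room for zeros of the cofactor on x = 0. *)
Lemma strict_irreducible : irreducible P1.
Proof.
have [w0 _ _] := strict_wpoly.
have P10 : coef2 P1 0 m <> 0 by rewrite P1m; apply/eqP/oner_neq0.
split; [by move=> e; apply: P10; rewrite e | exact: strict_nonunit|].
move=> g h e; case gu : (g \is a GRing.unit); [by left | right].
have [j gj] : exists j, coef2 g 0 j <> 0.
  apply: contrapT => c; apply: P10; rewrite e coef2M big_ord1 big1 // => b _.
  suff -> : coef2 g 0 b = 0 by rewrite mul0r.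
  by apply: contrapT => gb; apply: c; exists b.
have [k [_ hk]] := yreg_exists gj.
have [u [Q [uu Qw QE]]] := weierstrass_preparation hk.
have [k0|km] : k = 0%N \/ k = m.
- by apply: (strict_factor (U := u^-1 * h) Qw); rewrite QE e mulrCA mulrA mulKr.
- by move: hk gu; rewrite k0 fps2_unitE => -[_ /eqP ->].
rewrite fps2_unitE; apply/eqP => h0; apply: P10.
by rewrite e -km (coef2_yreg_mul h hk.1).2 h0 mulr0.
Qed.

(** The remainder r of g modulo P has degree less than m in y, and so has [bl r]. As a multiple of
    the Weierstrass polynomial P1 of degree m, [bl r] is zero. *)
Lemma strict_divides g : divides P1 (bl g) <-> divides P g.
Proof.
split=> [[s hs]|[a ->]]; last first.
  by exists (bl a * fpsX ^+ m); rewrite rmorphM /= blP mulrA.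
have [q [r [e dr]]] := weierstrass_division g (wpoly_yreg Pw).
have e1 : bl r = P1 * (s - bl q * fpsX ^+ m).
  move: hs; rewrite e rmorphD rmorphM /= blP.
  move=> hs; rewrite mulrBr [P1 * s]mulrC -hs -/P1; ring.
have s0 : s - bl q * fpsX ^+ m = 0.
  apply: fps2P => i j; apply: (wpoly_ydeg (n := 0) strict_wpoly) => //.
  by rewrite -e1 => i' j' le; rewrite blE dr // if_same.
exists q; rewrite e; suff -> : r = 0 by rewrite addr0.
by apply: bl_inj; rewrite e1 s0 mulr0 rmorph0.
Qed.

(** Modulo P1 all degrees in y are below m, and x^i y^j comes from the blow-up as soon as j <= i. So
    only the remainder coefficients with i, j < m can obstruct. *)
Lemma strict_codim : exists N : nat,
  codim [set v | exists r t : fps2 K, v = bl r + t * P1] = (N%:Z)%:E.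
Proof.
have W1 := strict_wpoly.
have [rem remP] := choice (fun g => (let: ex_intro q (ex_intro r h) :=
    weierstrass_division g (wpoly_yreg W1) in
  ex_intro (fun r => exists q, g = q * P1 + r /\ ydeg_lt m r) r (ex_intro _ q h))).
have remU g r q : g = q * P1 + r -> ydeg_lt m r -> rem g = r.
  move=> e dr; have [q' [e' dr']] := remP g.
  have e2 : rem g - r = P1 * (q - q').
    have -> : rem g = g - q' * P1 by rewrite {2}e' addrC addKr.
    by rewrite {1}e; ring.
  have s0 : q - q' = 0.
    apply: fps2P => i j; apply: (wpoly_ydeg (n := 0) W1) => //.
    by rewrite -e2 => i' j' le; rewrite coef2B dr // dr' // subrr.
  by apply/eqP; rewrite -subr_eq0 e2 s0 mulr0.
have rem_lin c g h : rem (c *: g + h) = c *: rem g + rem h.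
  have [q [e dr]] := remP g; have [q' [e' dr']] := remP h.
  apply: (remU _ _ (c *: q + q')).
    by rewrite {1}e {1}e' mulrDl scalerDr -!scalerAl; ring.
  by move=> i j le; rewrite coef2D coef2Z dr // dr' // mulr0 addr0.
apply: (codim_coord_fin (n := #|{: 'I_m * 'I_m}|)
  (phi := fun k g => coef2 (rem g) (enum_val k).1 (enum_val k).2)).
- split; first by exists 0, 0; rewrite rmorph0 mul0r addr0.
  move=> c _ _ [r [t ->]] [r' [t' ->]]; exists (c *: r + r'), (c *: t + t').
  by rewrite linearP scalerDr mulrDl -!scalerAl addrACA.
- by move=> k c g h; rewrite rem_lin coef2D coef2Z.
move=> g hg; have [q [e dr]] := remP g.
exists (Fps2 (fun i j => if (j < m)%N then coef2 (rem g) (i + j) j else 0)), q.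
rewrite {1}e addrC; congr (_ + _); apply: fps2P => i j; rewrite blE /=.
have [jm|mj] := ltnP j m; last by rewrite dr // if_same.
case: leqP => [ji|ij]; first by rewrite subnK.
have im : (i < m)%N by lia.
by have := hg (enum_rank (Ordinal im, Ordinal jm)); rewrite enum_rankK.
Qed.

Lemma strict_branch : branch P1 -> branch P.
Proof.
move=> b1; have [N hN] := strict_codim.
apply: (branch_pull (Phi := bl) (e := fpsX ^+ m) b1 strict_divides hN).
  exact: blP.
(* The Jacobian determinant of the blow-up is x, which P1 does not divide: its value is the finite
   number m. *)
have -> : jac (bl fpsX) (bl fpsY) = fpsX.
  rewrite jacE blX blY (derM (dx_derivation K)) (derM (dy_derivation K)).
  by rewrite dxX dxY dyX dyY; ring.
have [w0 w1 _] := strict_wpoly; have [y0 ym] := wpoly_yreg strict_wpoly.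
by move/(br_inf b1); rewrite (imult_X y0 ym).
Qed.

End BlowUp.
End Weierstrass.

(** * Contact orders and resolution of irreducible series *)

Section Automorphisms.
Variable K : fieldType.
Implicit Types (f g h u s t : fps2 K) (Phi Psi : {lrmorphism fps2 K -> fps2 K}).

Lemma irreducible_unitM u f : u \is a GRing.unit -> irreducible f ->
  irreducible (u * f).
Proof.
move=> uu [f0 fn fi]; split.
- by move=> e; apply: f0; rewrite -(mulKr uu f) e mulr0.
- by rewrite unitrMr.
move=> g h e; have := fi (u^-1 * g) h; rewrite -mulrA -e mulKr // => /(_ erefl).
by rewrite unitrMr ?unitrV.
Qed.

Lemma irreducible_hom Phi Psi f : cancel Phi Psi -> cancel Psi Phi ->
  irreducible f -> irreducible (Phi f).
Proof.
move=> PK KP [f0 fn fi].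
have uE g : (Psi g \is a GRing.unit) -> g \is a GRing.unit.
  by move=> /(rmorph_unit Phi) /=; rewrite KP.
split; first by move=> e; apply: f0; rewrite -(PK f) e rmorph0.
- by apply: contra fn => /(rmorph_unit Psi) /=; rewrite PK.
move=> g h e; have := fi (Psi g) (Psi h); rewrite -(rmorphM Psi g h) /= -e PK => /(_ erefl).
by case=> /uE; [left | right].
Qed.

Lemma branch_auto Phi Psi f : cancel Phi Psi -> cancel Psi Phi ->
  jac (Phi fpsX) (Phi fpsY) \is a GRing.unit -> branch (Phi f) -> branch f.
Proof.
move=> PK KP ju b.
apply: (branch_pull (Phi := Phi) (e := 1) (N := 0) b).
- move=> g; split=> [[a h]|[a ->]]; last by exists (Phi a); rewrite rmorphM.
  by exists (Psi a); apply: (can_inj PK); rewrite h rmorphM /= KP.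
- apply: etrans _ (codim_setT K); apply: eq_codim => v; split=> // _.
  by exists (Psi v), 0; rewrite KP mul0r addr0.
- by rewrite mul1r.
by move/(br_inf b); rewrite imult_unit.
Qed.

Lemma branch_unitM u f : u \is a GRing.unit -> branch (u * f) -> branch f.
Proof.
move=> uu b; pose I : {lrmorphism fps2 K -> fps2 K} := idfun.
apply: (branch_pull (Phi := I) (e := u^-1) (N := 0) b).
- move=> g; split=> [[a h]|[a h]].
    by exists (a * u); rewrite -mulrA -h.
  by exists (a * u^-1); rewrite -mulrA mulKr.
- apply: etrans _ (codim_setT K); apply: eq_codim => v; split=> // _.
  by exists v, 0; rewrite mul0r addr0.
- by rewrite mulKr.
have -> : jac (I fpsX) (I fpsY) = 1 by rewrite jacE dxX dyY dxY dyX; ring.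
by move/(br_inf b); rewrite imult_unit // unitr1.
Qed.

(** Only the initial form of f and the linear parts of Phi x and Phi y reach this degree: the
    coefficient is the initial form evaluated at their coefficients of y. *)
Lemma coef2_hom_low Phi m f : inm m f -> coef2 (Phi f) 0 m =
  \sum_(k < m.+1) coef2 f k (m - k) *
    (coef2 (Phi fpsX) 0 1 ^+ k * coef2 (Phi fpsY) 0 1 ^+ (m - k)).
Proof.
move=> hf; have := hom_ev Phi (N := m.+1) f => /(_ 0%N m).
rewrite mul1n add0n coef2B => /(_ (ltnSn _)) /eqP; rewrite subr_eq0 => /eqP ->.
set a := Phi fpsX; set b := Phi fpsY.
have ha : inm 1 a by apply: hom_local; exact: inmX.
have hb : inm 1 b by apply: hom_local; exact: inmY.
have hn (c : fps2 K) n : inm 1 c -> inm n (c ^+ n).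
  by move=> hc; have := @wtX _ 1 1 c n hc; rewrite muln1.
have hc (c : fps2 K) n : inm 1 c -> coef2 (c ^+ n) 0 n = coef2 c 0 1 ^+ n.
  by move=> h1; have := coef2_lowX0 n h1; rewrite muln1.
rewrite /ev coef2_sum.
under eq_bigr => p _ do rewrite coef2Z.
rewrite -(pair_bigA _ (fun p q : 'I_m.+1 =>
   coef2 f p q * coef2 (a ^+ p * b ^+ q) 0 m)) /=.
apply: eq_bigr => k _; have lk : (m - k < m.+1)%N by lia.
have km := ltn_ord k; rewrite ltnS in km.
rewrite (bigD1 (Ordinal lk)) // big1; last first.
  move=> j /eqP nj; have {}nj : (j : nat) <> (m - k)%N.
    by move=> e; apply: nj; apply: val_inj.
  have [lt|] := ltnP (k + j) m; first by rewrite hf ?mul0r // mul1n.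
  move=> ge; have : inm (k + j) (a ^+ k * b ^+ j) by apply: wtM; apply: hn.
  by move=> /(_ 0%N m) ->; [rewrite mulr0 | lia].
rewrite /= addr0; congr (_ * _).
have := coef2_low0 (hn a k ha) (hn b (m - k)%N hb); rewrite subnKC // => ->.
by rewrite !hc.
Qed.

Lemma coef2_hom_lowX Phi m f : inm m f -> coef2 (Phi f) m 0 =
  \sum_(k < m.+1) coef2 f k (m - k) *
    (coef2 (Phi fpsX) 1 0 ^+ k * coef2 (Phi fpsY) 1 0 ^+ (m - k)).
Proof.
have [sw [_ _ _ swC]] := swap_exists K; move=> hf.
by have := coef2_hom_low (sw \o Phi) hf; rewrite /= !swC.
Qed.

Lemma linear_change_exists (c : K) : exists Phi Psi, [/\ cancel Phi Psi,
  cancel Psi Phi, Phi fpsX = fpsX + c *: fpsY & Phi fpsY = fpsY].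
Proof.
have ex (d : K) : exists Phi, Phi fpsX = fpsX + d *: fpsY /\ Phi fpsY = fpsY.
  apply: subst_exists; last exact: inmY.
  by apply: wtD; [exact: inmX | apply: wtZ; exact: inmY].
have [Phi [pX pY]] := ex c; have [Psi [qX qY]] := ex (- c).
exists Phi, Psi; split=> // f.
  apply: (hom_ext (Phi := Psi \o Phi) (Psi := idfun)) => /=; last by rewrite pY.
  by rewrite pX linearD linearZ /= qX qY scaleNr subrK.
apply: (hom_ext (Phi := Phi \o Psi) (Psi := idfun)) => /=; last by rewrite qY.
by rewrite qX linearD linearZ /= pX pY scaleNr addrK.
Qed.

Definition xonly s := forall i j, (0 < j)%N -> coef2 s i j = 0.

Lemma hom_xonly Phi Psi s : xonly s -> Phi fpsX = Psi fpsX -> Phi s = Psi s.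
Proof.
move=> hs eX; apply: inm_eq0 => N.
have := wtB (@hom_ev _ Phi N s) (@hom_ev _ Psi N s).
suff -> : ev N (Phi fpsX) (Phi fpsY) s = ev N (Psi fpsX) (Psi fpsY) s.
  by congr (wt _ _ _); ring.
apply: eq_bigr => -[p q] _; rewrite eX.
case: q => [[|q] lq] /=; first by rewrite !expr0.
have -> : coef2 s p q.+1 = 0 by exact: hs.
by apply: (etrans (y := 0)); [|apply: esym]; exact: scale0r.
Qed.

Lemma shift_exists t : exists Phi, Phi fpsX = fpsX /\ Phi fpsY = fpsY + fpsX * t.
Proof.
apply: subst_exists; first exact: inmX.
by apply: wtD; [exact: inmY | apply: wtMr; exact: inmX].
Qed.

(** The factor x in y + x t makes every t admissible, in particular the constants that move a
    tangent. *)
Definition shift t : {lrmorphism fps2 K -> fps2 K} := sval (cid (shift_exists t)).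

Lemma shiftX t : shift t fpsX = fpsX.
Proof. by rewrite /shift; case: cid => Phi []. Qed.
Lemma shiftY t : shift t fpsY = fpsY + fpsX * t.
Proof. by rewrite /shift; case: cid => Phi []. Qed.

Lemma shift_fix s t : xonly t -> shift s t = t.
Proof. by move=> ht; apply: (hom_xonly (Psi := idfun)) => //=; rewrite shiftX. Qed.

(** A series in x alone is fixed by [shift s], so the shifts add up. *)
Lemma shift_comp s t f : xonly t -> shift s (shift t f) = shift (s + t) f.
Proof.
move=> ht; apply: (hom_ext (Phi := shift s \o shift t)) => /=; first by rewrite !shiftX.
by rewrite !shiftY rmorphD rmorphM /= shiftX shiftY shift_fix //; ring.
Qed.

Lemma xonlyN s : xonly s -> xonly (- s).
Proof. by move=> h i j lt; rewrite coef2N h ?oppr0. Qed.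
Lemma xonlyD s t : xonly s -> xonly t -> xonly (s + t).
Proof. by move=> h h' i j lt; rewrite coef2D h ?h' ?addr0. Qed.

Lemma shift0 f : shift 0 f = f.
Proof.
apply: (hom_ext (Psi := idfun)) => /=; first by rewrite shiftX.
by rewrite shiftY mulr0 addr0.
Qed.

Lemma shiftK t : xonly t -> cancel (shift t) (shift (- t)).
Proof. by move=> ht f; rewrite shift_comp // addNr shift0. Qed.

Lemma shiftNK t : xonly t -> cancel (shift (- t)) (shift t).
Proof. by move=> /xonlyN ht f; rewrite shift_comp // subrr shift0. Qed.

Lemma shift_branch t f : xonly t -> branch (shift t f) -> branch f.
Proof.
move=> ht; apply: (branch_auto (shiftK ht) (shiftNK ht)).
rewrite shiftX shiftY jacE dxX dyX (derD (dy_derivation K)) (derM (dy_derivation K)).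
rewrite dyY dyX; have -> : fps2_dy t = 0.
  by apply: fps2P => i j /=; rewrite ht // mul0rn.
by rewrite mul0r mulr0 !addr0 mul0r subr0 mulr1 unitr1.
Qed.

Lemma shift_irreducible t f : xonly t -> irreducible f -> irreducible (shift t f).
Proof. by move=> ht; apply: irreducible_hom (shiftK ht) (shiftNK ht). Qed.

Lemma shift_wt k w t f : (0 < k)%N ->
  (forall i j, (i.+1 < k)%N -> coef2 t i j = 0) ->
  wt k w f -> wt k w (shift t f).
Proof.
move=> k0 ht; apply: hom_wt => //; rewrite shiftY; apply: wtD => i j lt.
  rewrite /=; case: eqP => //= _; case: eqP => // j1; move: lt; rewrite j1; lia.
by rewrite coef2XM; case: i lt => // i lt; apply: ht; lia.
Qed.

Lemma coef2_shift_low t m f : inm m f -> coef2 (shift t f) 0 m = coef2 f 0 m.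
Proof.
move=> hf; rewrite coef2_hom_low // shiftX shiftY coef2D coef2XM /= addr0.
rewrite big_ord_recl big1 => [|k _]; last by rewrite exprS mul0r mul0r mulr0.
by rewrite addr0 subn0 expr0 expr1n !mulr1.
Qed.

(* After a shift y -> y + x t(x), the Newton polygon of f lies above the segment
   from (0, m) to (N m, 0). *)
Definition contact N m f := exists t, xonly t /\ wt N (N * m) (shift t f).

Lemma wt_slope N M m f : (M <= N)%N -> wt N (N * m) f -> wt M (M * m) f.
Proof.
move=> MN hf i j lt; apply: hf.
have [mj|jm] := leqP m j; first by have := leq_mul2l M m j; lia.
rewrite -(subnKC (ltnW jm)) !mulnDr in lt *.
by have := leq_mul2r (m - j) M N; lia.
Qed.

(** Let t_i be the first nonzero coefficient of t and k = i + 1 < N. Apart from c y^m, all terms of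
    g have weight above k m, so x^(k m) occurs in the shifted g with coefficient c t_i^m <> 0, below
    the segment. Shifts for different N thus agree to increasing order. *)
Lemma contact_uniq N m g t : (0 < m)%N -> coef2 g 0 m <> 0 -> xonly t ->
  wt N (N * m) g -> wt N (N * m) (shift t g) ->
  forall i, (i.+1 < N)%N -> coef2 t i 0 = 0.
Proof.
move=> m0 gm ht hg hs; elim/ltn_ind => i IH iN; pose k := i.+1.
have t0 i' j : (i' < i)%N -> coef2 t i' j = 0.
  by move=> lt; case: j => [|j]; [apply: IH; lia | apply: ht].
pose c := coef2 g 0 m; pose g' := g - c *: fpsY ^+ m.
have Ycoef i' j : coef2 (fpsY ^+ m : fps2 K) i' j = ((i' == 0%N) && (j == m))%:R.
  by rewrite -[fpsY ^+ m]mul1r -(expr0 fpsX) coef2_monomial.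
have hg' : wt k (k * m).+1 g'.
  move=> i' j lt; rewrite coef2B coef2Z Ycoef.
  have [jm|mj] := ltnP j m.
    rewrite (ltn_eqF jm) andbF mulr0 subr0; apply: hg; move: lt.
    rewrite ltnS -(subnKC (ltnW jm)) !mulnDr /k => lt.
    have : (i.+1 * (m - j) < N * (m - j))%N by rewrite ltn_pmul2r // subn_gt0.
    by lia.
  have jm : j = m.
    by apply/eqP; rewrite eqn_leq mj andbT -(leq_pmul2l (ltn0Sn i)); lia.
  have i0 : i' = 0%N by move: lt; rewrite jm; lia.
  by rewrite jm i0 !eqxx mulr1 subrr.
have hsg' : wt k (k * m).+1 (shift t g').
  by apply: shift_wt => // i' j lt; apply: t0.
have e : shift t g = c *: (fpsY + fpsX * t) ^+ m + shift t g'.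
  by rewrite -shiftY -rmorphXn -linearZ -rmorphD /g' addrC subrK.
have [t' tE] : exists t', t = fpsX ^+ i * t' by apply: divXn => i' j; apply: t0.
have ti : coef2 t i 0 = coef2 t' 0 0 by rewrite tE coef2XnM leqnn subnn.
have [q qE] : exists q, (fpsY + fpsX * t) ^+ m = (fpsX * t) ^+ m + fpsY * q.
  exists (\sum_(l < m) (fpsY + fpsX * t) ^+ (m.-1 - l) * (fpsX * t) ^+ l).
  have := subrXX (fpsY + fpsX * t) (fpsX * t) m; rewrite addrK => <-.
  by rewrite [RHS]addrC subrK.
rewrite ti; have : coef2 (shift t g) (k * m) 0 = 0 by apply: hs; rewrite muln0 addn0 ltn_pmul2r.
rewrite e qE coef2D hsg' ?muln0 ?addn0 // addr0 coef2Z coef2D coef2YM addr0.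
rewrite tE mulrA -exprS exprMn -exprM coef2XnM leqnn subnn.
have := coef2_lowX0 m (@wt0 _ 1 t'); rewrite muln0 => -> /eqP.
rewrite mulf_eq0 => /orP [/eqP /gm []|].
by rewrite expf_eq0 => /andP [_ /eqP].
Qed.

(* If every contact order were attained, the shifts would converge to a curve
   y = s(x) along which f is divisible by y^m. *)
Lemma contact_bounded m f : (1 < m)%N -> irreducible f -> inm m f ->
  coef2 f 0 m <> 0 -> exists N, ~ contact N m f.
Proof.
move=> m1 fi hf fm; apply: contrapT => hN.
have {}hN N : contact N m f by apply: contrapT => c; apply: hN; exists N.
have [T TP] := choice hN.
(* Coefficient i of [T N] does not depend on N once i + 1 < N, and [i.+2] is the first such N. *)
pose s := Fps2 (fun i j => if j is 0%N then coef2 (T i.+2) i 0 else 0).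
have xs : xonly s by move=> i [].
have sT N i : (i.+1 < N)%N -> coef2 s i 0 = coef2 (T N) i 0.
  move=> lt; have [xN wN] := TP N; have [xi wi] := TP i.+2.
  have h : coef2 (T N - T i.+2) i 0 = 0.
    apply: (@contact_uniq i.+2 m (shift (T i.+2) f)) => //; first exact: ltnW.
    - by rewrite coef2_shift_low.
    - by apply: xonlyD => //; apply: xonlyN.
    rewrite shift_comp // subrK; exact: wt_slope wN.
  by move: h; rewrite coef2B /= => /eqP; rewrite subr_eq0 => /eqP ->.
have sw N : (0 < N)%N -> wt N (N * m) (shift s f).
  move=> N0; have [xN wN] := TP N.
  rewrite -[s](subrK (T N)) -shift_comp //; apply: shift_wt => // i [|j] lt.
    by rewrite coef2B (sT N) // subrr.
  by rewrite coef2B xN // subr0.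
have [h hE] : exists h, shift s f = fpsY ^+ m * h.
  (* For j < m the monomial x^i y^j lies below the segment of slope [i.+1]. Once y^m divides the
     shifted f, [1 < m] gives a factorization into two nonunits. *)
  apply: divYn => i j jm; apply: (sw i.+1) => //; nia.
have [_ _ si] := shift_irreducible xs fi.
have := si fpsY (fpsY ^+ m.-1 * h); rewrite mulrA -exprS prednK; last exact: ltnW.
move=> /(_ hE) [] /=; rewrite fps2_unitE ?eqxx //.
by rewrite coef2YnM leqNgt -ltnS prednK ?m1 ?eqxx //; apply: ltnW.
Qed.

(** The smooth case: up to a unit f is y + x r(x), and a shift turns it into y. *)
Lemma branch_yreg1 f : yreg 1 f -> branch f.
Proof.
move=> /weierstrass_preparation [u [P [uu [P0 P1 Pd] PE]]].
apply: (branch_unitM uu); rewrite -PE.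
pose r := Fps2 (fun i j => if j is 0%N then coef2 P i.+1 0 else 0).
have xr : xonly r by move=> i [].
apply: (shift_branch (xonlyN xr)).
have -> : P = fpsY + fpsX * r.
  apply: fps2P => i j; rewrite coef2D coef2XM.
  case: j => [|[|j]] /=; [|rewrite P1|by rewrite Pd //; case: i => [|i] /=; rewrite ?andbF addr0].
    by case: i => [|i] /=; rewrite ?P0 /= ?addr0 ?add0r.
  by case: i => [|i] /=; rewrite addr0.
rewrite rmorphD rmorphM /= shiftX shiftY (shift_fix (- r) xr).
rewrite (mulrN fpsX r) subrK.
exact: branch_Y.
Qed.

End Automorphisms.

(** * Resolution over an algebraically closed field *)

Section Branches.
Variable K : closedFieldType.
Implicit Types (f g h P : fps2 K).

(** A root of p - 1 is a nonroot of p; only a constant p - 1 needs a separate look. The lemma serves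
    as infinitude of K. *)
Lemma closed_nonroot (p : {poly K}) : p != 0 -> exists x, p.[x] != 0.
Proof.
move=> p0; have [s1|s1] := eqVneq (size (p - 1)) 1%N; last first.
  have [x /rootP] := closed_rootP _ s1; rewrite hornerD hornerN hornerC => /eqP.
  by rewrite subr_eq0 => /eqP e; exists x; rewrite e oner_neq0.
have /size_poly1P [c _ e] : size (p - 1) == 1%N by apply/eqP.
exists 0; apply: contraNneq p0 => h.
have pE : p = (c + 1)%:P by rewrite polyCD -e subrK.
by move: h; rewrite pE hornerC => ->.
Qed.

Lemma yreg_of_low m f : inm m f -> coef2 f 0 m <> 0 -> yreg m f.
Proof. by move=> hf fm; split=> // j lt; apply: hf; rewrite mul1n add0n. Qed.

(** The direction (c : 1) lies outside the tangent cone, so x -> x + c y makes f regular in y of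
    order m. *)
Lemma tangent_coordinate m f : inm m f -> ~ inm m.+1 f ->
  exists c : K, \sum_(k < m.+1) coef2 f k (m - k) * c ^+ k <> 0.
Proof.
move=> h1 h2; have [a [am fa _]] := not_inmS h1 h2.
pose p := \poly_(k < m.+1) coef2 f k (m - k).
have p0 : p != 0.
  apply/eqP => e; apply: fa; have := congr1 (fun q : {poly K} => q`_a) e.
  by rewrite coef_poly ltnS am coef0.
have [c /eqP hc] := closed_nonroot p0; exists c.
by move: hc; rewrite horner_poly.
Qed.

(** The direction (1 : a) is tangent to f, and y -> y + a x turns it into y = 0. *)
Lemma tangent_root m f : (0 < m)%N -> coef2 f 0 m <> 0 ->
  exists a : K, \sum_(k < m.+1) coef2 f k (m - k) * a ^+ (m - k) = 0.
Proof.
move=> m0 fm; pose p := \poly_(k < m.+1) coef2 f (m - k) k.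
have sp : size p = m.+1 by rewrite size_poly_eq // subnn; apply/eqP.
have /closed_rootP [a /rootP] : size p != 1%N by rewrite sp; lia.
rewrite horner_poly => e; exists a; rewrite -[RHS]e.
rewrite (reindex_inj rev_ord_inj) /=; apply: eq_bigr => k _.
by rewrite subSS subKn // -ltnS.
Qed.

(* Each blow-up either lowers the multiplicity or the contact order by one. *)
Lemma branch_contact m N f :
  (forall k g, (k < m)%N -> irreducible g -> inm k g -> ~ inm k.+1 g -> branch g) ->
  (1 < m)%N -> irreducible f -> inm m f -> coef2 f 0 m <> 0 ->
  ~ contact N m f -> branch f.
Proof.
move=> IHm m1; have m0 := ltnW m1.
elim: N f => [|N IHN] f fi hf fm hN.
  by case: hN; exists 0; split=> //; apply: wt0.
have [a ha] := tangent_root m0 fm.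
(* The constant shift by a kills the coefficient of x^m, as [strict_wpoly] requires. *)
pose A : fps2 K := a *: 1.
have xA : xonly A.
  by move=> i j lt; rewrite coef2Z coef21 (gtn_eqF lt) andbF mulr0.
pose f1 := shift A f.
have f1i : irreducible f1 by apply: shift_irreducible.
have f1m : inm m f1 by apply: hom_inm.
have f10 : coef2 f1 0 m <> 0 by rewrite coef2_shift_low.
have f1X : coef2 f1 m 0 = 0.
  rewrite /f1 coef2_hom_lowX // shiftX shiftY -[RHS]ha; apply: eq_bigr => k _.
  by rewrite coef2D coef2XM /= add0r mulr1 expr1n mul1r.
have [u [P [uu Pw PE]]] := weierstrass_preparation (yreg_of_low f1m f10).
have Pi : irreducible P by rewrite PE; apply: irreducible_unitM.
have Pm : inm m P by rewrite PE; apply: wtMl.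
have PX : coef2 P m 0 = 0.
  have [sw [_ _ _ swC]] := swap_exists K.
  rewrite -swC PE mulrC rmorphM /=.
  have [|_ ->] := @coef2_yreg_mul _ m (sw f1) (sw u).
    by move=> j lt; rewrite swC f1m // muln0 addn0.
  by rewrite swC f1X mul0r.
have [bl [blX blY blE]] := blowup_exists K.
apply: (shift_branch xA); apply: (branch_unitM uu); rewrite -/f1 -PE.
apply: (strict_branch blX blY blE m0 Pm Pw PX Pi).
have P1i := strict_irreducible blE m0 Pm Pw PX Pi.
have [P10 _ _] := strict_wpoly blE m0 Pm Pw PX Pi.
have blP : bl P = fpsX ^+ m * strict_transform m P by apply: bl_strict => //; case: Pw.
set P1 := strict_transform m P in P1i P10 blP *.
have P1m : coef2 P1 0 m <> 0 by rewrite P10 eqxx; apply/eqP/oner_neq0.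
have [P1n0 _ _] := P1i; have [k [k1 k2]] := order_exists P1n0.
have [km|mk] := ltnP k m; first exact: IHm k1 k2.
have P1inm : inm m P1 by apply: wt_le k1.
apply: IHN => // -[t [xt ht]]; apply: hN.
(* Contact of order N of the strict transform along t is contact of order [N.+1] of f along x t +
   A. *)
exists (fpsX * t + A); split.
  apply: xonlyD => // i j lt; rewrite coef2XM; case: i => // i; exact: xt.
have xXt : xonly (fpsX * t).
  by move=> i j lt; rewrite coef2XM; case: i => // i; exact: xt.
rewrite -shift_comp // -/f1.
have -> : f1 = u^-1 * P by rewrite PE mulKr.
rewrite rmorphM; apply: wtMl.
(* Both composites send y to x (y + x t): the blow-up divides the shift x t by x. *)
have blG : bl (shift (fpsX * t) P) = fpsX ^+ m * shift t P1.
  rewrite -[fpsX ^+ m](_ : shift t (fpsX ^+ m) = _); last by rewrite rmorphXn /= shiftX.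
  rewrite -rmorphM /= -blP.
  apply: (hom_ext (Phi := bl \o shift (fpsX * t)) (Psi := shift t \o bl)) => /=.
    by rewrite !(shiftX, blX).
  rewrite !(shiftY, blY) rmorphD !rmorphM /= blX blY shiftX shiftY.
  have -> : bl t = t by apply: (hom_xonly (Psi := idfun)) => //=.
  by rewrite mulrDr.
move=> i j lt.
have := congr1 (fun g => coef2 g (i + j) j) blG.
rewrite blE leq_addl addnK => ->; rewrite coef2XnM.
by case: leqP => // le; apply: ht; nia.
Qed.

Theorem irreducible_branch f : irreducible f -> branch f.
Proof.
move=> fi; have [f0 _ _] := fi; have [m [h1 h2]] := order_exists f0.
elim/ltn_ind: m f fi {f0} h1 h2 => m IHm f fi h1 h2.
have IH k g : (k < m)%N -> irreducible g -> inm k g -> ~ inm k.+1 g -> branch g.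
  by move=> km gi g1 g2; apply: IHm km g gi g1 g2.
have [c hc] := tangent_coordinate h1 h2.
have [Phi [Psi [PK KP PX PY]]] := linear_change_exists c.
apply: (branch_auto PK KP).
  rewrite PX PY jacE dxY dyY (derD (dx_derivation K)) (derZ (dx_derivation K)).
  by rewrite dxX dxY scaler0 addr0 mulr0 subr0 mulr1 unitr1.
have gi := irreducible_hom PK KP fi.
have g1 : inm m (Phi f) by apply: hom_inm.
have gm : coef2 (Phi f) 0 m <> 0.
  rewrite coef2_hom_low // PX PY; under eq_bigr => k _.
    rewrite coef2D coef2Z /= add0r mulr1 expr1n mulr1; over.
  exact: hc.
have [m1|m1|m1] := ltngtP m 1.
- case: gi => _ /nunitP hn _; case: gm; move: m1; case: (m) => // _.
  exact: (inm1 _).1.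
- have [N hN] := contact_bounded m1 gi g1 gm.
  exact: branch_contact IH m1 gi g1 gm hN.
by apply: branch_yreg1; rewrite -m1; apply: yreg_of_low.
Qed.

End Branches.

(** * Multiplicity and polar intersection numbers *)

Section Ereal.
Implicit Types (a b x y : \bar int).

Lemma min_cases x y : (x <= y /\ Order.min x y = x)%E \/ (y <= x /\ Order.min x y = y)%E.
Proof. by case: leP => h; [left | right; split => //; apply: ltW]. Qed.

Lemma ereal_shift_le (m n : nat) x y : (0 <= x)%E -> (0 <= y)%E ->
  (x + m%:Z%:E <= y + n%:Z%:E)%E ->
  (x - n%:Z%:E + 1 <= y - m%:Z%:E + 1)%E.
Proof.
by move: x y => [x||] [y||] //= _ _; rewrite -?EFinD ?lee_fin ?leey //; lia.
Qed.

Lemma ereal_shift_eq (m n : nat) x y : (0 <= x)%E -> (0 <= y)%E ->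
  (x + m%:Z%:E = y + n%:Z%:E)%E ->
  (x - n%:Z%:E + 1 = y - m%:Z%:E + 1)%E.
Proof.
by move=> x0 y0 e; apply/eqP; rewrite eq_le !ereal_shift_le // e.
Qed.

Lemma ereal_shift_ge (n r : nat) x : (0 <= x)%E -> (r <= n)%N ->
  ((1 - n%:Z)%:E <= x - r%:Z%:E + 1)%E.
Proof.
by move: x => [x||] //=; rewrite -?EFinD ?lee_fin ?leey //; lia.
Qed.

End Ereal.

Section Multiplicity.
Variable K : closedFieldType.
Implicit Types (f g h q u : fps2 K) (Phi Psi : {lrmorphism fps2 K -> fps2 K}).

(* After a generic linear change of coordinates mt f = imult f (x - c y), and
   imult f is a valuation. *)
Lemma mt_branch f : branch f -> f <> 0 ->
  ((mt f)%:Z)%:E = Order.min (imult f fpsX) (imult f fpsY).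
Proof.
move=> b f0; have [h1 h2] := mt_inm f0; set m := mt f in h1 h2 *.
have [c hc] := tangent_coordinate h1 h2.
have [Phi [Psi [PK KP PX PY]]] := linear_change_exists c.
have g1 : inm m (Phi f) by apply: hom_inm.
have gm : coef2 (Phi f) 0 m <> 0.
  rewrite coef2_hom_low // PX PY; under eq_bigr => k _.
    rewrite coef2D coef2Z /= add0r mulr1 expr1n mulr1; over.
  exact: hc.
apply/eqP; rewrite eq_le; apply/andP; split.
  rewrite le_min; apply/andP; split.
    case: imultP => [n e|]; last by rewrite leey.
    by rewrite lee_fin lez_nat; apply: (imult_X_ge e) => j lt; apply: h1; lia.
  case: imultP => [n e|]; last by rewrite leey.
  by rewrite lee_fin lez_nat; apply: (imult_Y_ge e) => j lt; apply: h1; lia.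
have <- : imult f (fpsX + (- c *: 1) * fpsY) = (m%:Z)%:E.
  rewrite -(imult_hom f _ (Bijective PK KP)).
  have -> : Phi (fpsX + (- c *: 1) * fpsY) = fpsX.
    by rewrite rmorphD rmorphM /= linearZ /= rmorph1 PX PY -scalerAl mul1r scaleNr addrK.
  by have [y0 ym] := yreg_of_low g1 gm; apply: imult_X.
apply: le_trans (br_add b _ _); rewrite (br_mul b).
move: (imult_ge0 f (- c *: 1)); move: (imult f fpsX) (imult f fpsY) (imult f _).
move=> x y z z0; rewrite le_min ge_min lexx /= ge_min; apply/orP; right.
by case: y z z0 => [y||] [z||] //= z0; rewrite ?leey // -EFinD lee_fin lerDr.
Qed.

Lemma imultZ f g c : c != 0 -> imult f (c *: g) = imult f g.
Proof.
move=> c0; rewrite -[c *: g]mul1r -scalerAr scalerAl imult_unitMr //.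
by rewrite fps2_unitE coef2Z coef21 mulr1.
Qed.

Lemma imultN f g : imult f (- g) = imult f g.
Proof. by rewrite -scaleN1r imultZ // oppr_eq0 oner_neq0. Qed.

Lemma branch_neq0 f : branch f -> f <> 0.
Proof.
move=> b f0; have /(br_inf b) [h] : imult f fpsY = +oo%E.
  by apply: imult_Y_inf => i; rewrite f0.
rewrite f0 mulr0 => /(congr1 (fun g => coef2 g 0 1)) /eqP /=.
by rewrite oner_eq0.
Qed.

Lemma imult_comb f g h a b : branch f ->
  (Order.min (imult f g) (imult f h) <= imult f (a *: g + b *: h)%R)%E.
Proof.
move=> br.
have le c k : (imult f k <= imult f (c *: k)%R)%E.
  have [->|c0] := eqVneq c 0; last by rewrite imultZ.
  rewrite scale0r (_ : imult f 0 = +oo%E) ?leey //.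
  by apply/(br_inf br); exists 0; rewrite mul0r.
apply: le_trans (br_add br _ _); move: (le a g) (le b h).
move: (imult f g) (imult f h) (imult f _) (imult f _) => x y z w xz yw.
by rewrite le_min !ge_min xz yw orbT.
Qed.

(** At most one direction is exceptional: from two independent ones, g and h would be recovered by
    Cramer's rule, and both would have value above the minimum. *)
Lemma generic_min f g h : branch f -> exists2 q : K * K, q != (0, 0) &
  forall a b, a * q.2 != b * q.1 ->
    imult f (a *: g + b *: h) = Order.min (imult f g) (imult f h).
Proof.
move=> br; set mu := Order.min _ _.
have ge a b : (mu <= imult f (a *: g + b *: h)%R)%E by apply: imult_comb.
have [[[a0 b0] [q0 /eqP ne]]|none] := pselect (exists q : K * K, q != (0, 0) /\
    imult f (q.1 *: g + q.2 *: h) <> mu); last first.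
  (* Without exceptional direction any nonzero pair will do. *)
  exists (1, 0) => [|a b ne]; first by rewrite xpair_eqE oner_eq0.
  apply: contrapT => c; apply: none; exists (a, b); split => //.
  by apply: contra ne; rewrite xpair_eqE => /andP [/eqP -> /eqP ->]; rewrite !mul0r.
exists (a0, b0) => //= a b det; apply/eqP; rewrite eq_le ge andbT leNgt.
apply/negP => gt; move: ne; rewrite /= => ne.
have gt0 : (mu < imult f (a0 *: g + b0 *: h)%R)%E by rewrite lt_neqAle eq_sym ne ge.
set w := a *: g + _ in gt; set w0 := a0 *: g + _ in gt0.
have d0 : a * b0 - b * a0 != 0 by rewrite subr_eq0.
have gE : (a * b0 - b * a0) *: g = b0 *: w + (- b) *: w0.
  rewrite /w /w0 !scalerDr !scalerA.
  rewrite addrACA -!scalerDl.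
  by rewrite (_ : b0 * b + - b * b0 = 0) ?scale0r ?addr0; [congr (_ *: _)|]; ring.
have hE : (a * b0 - b * a0) *: h = (- a0) *: w + a *: w0.
  rewrite /w /w0 !scalerDr !scalerA.
  rewrite addrACA -!scalerDl.
  by rewrite (_ : - a0 * a + a * a0 = 0) ?scale0r ?add0r; [congr (_ *: _)|]; ring.
suff : (mu < mu)%E by rewrite ltxx.
rewrite {2}/mu lt_min -(imultZ f g d0) -(imultZ f h d0) gE hE.
by apply/andP; split; (apply: lt_le_trans (imult_comb _ _ _ _ br));
  rewrite lt_min; apply/andP; split.
Qed.

(** If q does not divide h, multiplication by q embeds the quotient by (f, h) into the quotient by
    (q f, h), because q is prime; the cokernel is the quotient by (q, h). If q divides h, both sides
    are infinite. *)
Lemma imult_factor q f h : branch q ->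
  imult (q * f) h = (imult q h + imult f h)%E.
Proof.
move=> b; have [/(br_inf b) qh|nqh] := pselect (divides q h).
  rewrite qh; have : (imult q h <= imult (q * f)%R h)%E.
    apply: imult_mono => k [x [y ->]]; exists (x * f), y; ring.
  by rewrite qh; case: (imultP f h) => [n _|_]; case: (imultP (q * f) h).
have [lam lamE] := mul_linear_exists q; rewrite 3!imultE.
apply: (codim_ext (lam := lam)); first exact: ideal2_subspace.
  move=> v; split=> [[x [y ->]]|[r [_ [[x [y ->]] ->]]]].
    exists x, (y * h); rewrite lamE [x * q]mulrC; split=> //.
    by exists 0, y; rewrite mul0r add0r.
  by exists (r + x * f), y; rewrite lamE; ring.
move=> r; rewrite lamE; split=> [[x [y ->]]|[x [y e]]].
  by exists x, (q * y); ring.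
have [|[z ez]|//] := @branch_prime _ q y h b.
  by exists (r - x * f); rewrite mulrBl [r * q]mulrC e; ring.
by exists x, z; apply: (fps2_mulI (branch_neq0 b)); rewrite e ez; ring.
Qed.

End Multiplicity.

(** * The invariants kappa and gamma *)

Section Factors.
Variable K : closedFieldType.
Implicit Types (f g h q u r : fps2 K) (Phi Psi : {lrmorphism fps2 K -> fps2 K}).

Definition dir (a b : K) f := a *: fps2_dx f + b *: fps2_dy f.

Lemma dirM a b g h : dir a b (g * h) = dir a b g * h + g * dir a b h.
Proof.
rewrite /dir (derM (dx_derivation K)) (derM (dy_derivation K)).
rewrite !scalerDr !mulrDl mulrDr -!scalerAl -!scalerAr; ring.
Qed.

(** Modulo q the derivative of q r is r times that of q. *)
Lemma imult_dirM q r a b : branch q ->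
  imult q (dir a b (q * r)) = (imult q r + imult q (dir a b q))%E.
Proof. by move=> br; rewrite dirM imultDM mulrC (br_mul br). Qed.

Lemma imult1 f : imult f 1 = 0%E.
Proof. by rewrite imult_unit ?unitr1. Qed.

Lemma imult_prodr q I (s : seq I) (P : pred I) (F : I -> fps2 K) : branch q ->
  imult q (\prod_(i <- s | P i) F i) = (\sum_(i <- s | P i) imult q (F i))%E.
Proof.
move=> br; elim/big_rec2: _ => [|i x y _ <-]; first exact: imult1.
exact: br_mul.
Qed.

Lemma imult_prodl u h I (s : seq I) (F : I -> fps2 K) : u \is a GRing.unit ->
  (forall i, branch (F i)) ->
  imult (u * \prod_(i <- s) F i) h = (\sum_(i <- s) imult (F i) h)%E.
Proof.
move=> uu br; elim: s => [|i s IH].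
  by rewrite !big_nil mulr1 imultC imult_unit.
by rewrite !big_cons mulrCA imult_factor // IH.
Qed.

Lemma divides_X_unit f : irreducible f -> divides f fpsX ->
  exists2 c, c \is a GRing.unit & f = c * fpsX.
Proof.
move=> [f0 fn _] [c cE].
have X0 : (fpsX : fps2 K) <> 0.
  by move=> /(congr1 (fun g => coef2 g 1 0)) /eqP /=; rewrite oner_eq0.
have c0 : c <> 0 by move=> c0; apply: X0; rewrite cE c0 mul0r.
have cu : c \is a GRing.unit.
  rewrite fps2_unitE; apply/eqP => c00.
  have := wtM ((inm1 c).2 c00) ((nunitP f).1 fn); rewrite -cE => /(_ 1%N 0%N isT) /=.
  by move/eqP; rewrite oner_eq0.
by exists c^-1; rewrite ?unitrV // cE mulKr.
Qed.

Lemma divides_Y_unit f : irreducible f -> divides f fpsY ->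
  exists2 c, c \is a GRing.unit & f = c * fpsY.
Proof.
move=> [f0 fn _] [c cE].
have Y0 : (fpsY : fps2 K) <> 0.
  by move=> /(congr1 (fun g => coef2 g 0 1)) /eqP /=; rewrite oner_eq0.
have c0 : c <> 0 by move=> c0; apply: Y0; rewrite cE c0 mul0r.
have cu : c \is a GRing.unit.
  rewrite fps2_unitE; apply/eqP => c00.
  have := wtM ((inm1 c).2 c00) ((nunitP f).1 fn); rewrite -cE => /(_ 0%N 1%N isT) /=.
  by move/eqP; rewrite oner_eq0.
by exists c^-1; rewrite ?unitrV // cE mulKr.
Qed.

Lemma mt_axis c f : c \is a GRing.unit -> f = c * fpsX \/ f = c * fpsY -> mt f = 1%N.
Proof.
rewrite fps2_unitE => /eqP c0 fE; apply: mtP.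
  by case: fE => ->; apply: wtMl; [exact: inmX | exact: inmY].
case: fE => -> h; [have := h 1%N 0%N isT | have := h 0%N 1%N isT];
  by rewrite mulrC ?coef2XM ?coef2YM.
Qed.

(** Both f and f_x lie in the ideal of x^(n-1) and y. *)
Lemma imult_dx_ge f n : imult f fpsY = (n%:Z)%:E ->
  (((n.-1)%:Z)%:E <= imult f (fps2_dx f))%E.
Proof.
move=> e; have f0 i : (i < n)%N -> coef2 f i 0 = 0.
  by case: (axisP f) => [m h _|_]; rewrite e // => -[->]; apply: h.
rewrite -(codim_axis K) imultE; apply: codim_mono.
- exact: ideal2_subspace.
- split=> [i //|c u v hu hv i]; first by rewrite coef2D coef2Z hu hv mulr0 addr0.
move=> _ [a [b ->]] i; have li := ltn_ord i.
rewrite coef2D !coef2M !big1 ?addr0 // => k _;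
  rewrite big_ord1 [X in _ * X](_ : _ = 0) ?mulr0 //.
  by rewrite /= f0 ?mul0rn //; have := ltn_ord k; lia.
by apply: f0; have := ltn_ord k; lia.
Qed.

Lemma imult_dy_ge f n : imult f fpsX = (n%:Z)%:E ->
  (((n.-1)%:Z)%:E <= imult f (fps2_dy f))%E.
Proof.
have [sw [swK swX swY swC]] := swap_exists K.
rewrite -(imult_hom f fpsX (inv_bij swK)) -(imult_hom f _ (inv_bij swK)) swX.
move=> /imult_dx_ge; congr (_ <= imult _ _)%E.
by apply: fps2P => i j; rewrite swC /= swC.
Qed.

Lemma branch_jac_mt f : branch f ->
  forall a b : nat, imult f fpsX = (a%:Z)%:E -> imult f fpsY = (b%:Z)%:E ->
  (a%:R != 0 :> K ->
    (imult f (fps2_dy f) + b%:Z%:E <= imult f (fps2_dx f) + a%:Z%:E)%E) /\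
  (b%:R != 0 :> K ->
    (imult f (fps2_dx f) + a%:Z%:E <= imult f (fps2_dy f) + b%:Z%:E)%E).
Proof.
move=> br a b ea eb.
have jX : jac f fpsX = - fps2_dy f by rewrite jacE dxX dyX; ring.
have jY : jac f fpsY = fps2_dx f by rewrite jacE dxY dyY; ring.
split=> h.
  by have := br_jac br fpsY ea h; rewrite jX jY imultN ea eb.
by have := br_jac br fpsX eb h; rewrite jX jY imultN ea eb.
Qed.

(** In use a, b are the values of x, y and A, B those of f_x, f_y. Since min(a, b) is at most the
    number subtracted, the left side is at most A + 1 and at most B + 1. *)
Lemma min_arith (a b : nat) (A B : \bar int) : (0 <= A)%E -> (0 <= B)%E ->
  (Order.min (A - b%:Z%:E + 1) (B - a%:Z%:E + 1) + Order.min a%:Z%:E b%:Z%:E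
     <= Order.min A B + 1%N%:Z%:E)%E.
Proof.
move=> A0 B0.
case: (min_cases A B) => -[h1 ->]; case: (min_cases a%:Z%:E b%:Z%:E) => -[h2 ->];
case: (min_cases (A - b%:Z%:E + 1)%E (B - a%:Z%:E + 1)%E) => -[h3 ->];
move: A B A0 B0 h1 h2 h3 => [A||] [B||] //=;
rewrite ?leey // -?EFinD ?lee_fin //; lia.
Qed.

(** The last hypothesis selects B - a + 1 as the minimum, and adding a gives B + 1. *)
Lemma min_arith_eq (a b : nat) (A B : \bar int) : (0 <= A)%E -> (0 <= B)%E ->
  (a <= b)%N -> (B + b%:Z%:E <= A + a%:Z%:E)%E ->
  (Order.min A B + 1%N%:Z%:E <=
   Order.min (A - b%:Z%:E + 1) (B - a%:Z%:E + 1) + a%:Z%:E)%E.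
Proof.
move=> A0 B0 ab.
case: (min_cases A B) => -[h1 ->];
case: (min_cases (A - b%:Z%:E + 1)%E (B - a%:Z%:E + 1)%E) => -[h3 ->];
move: A B A0 B0 h1 h3 => [A||] [B||] //=;
rewrite ?leey // -?EFinD ?lee_fin //; lia.
Qed.

Lemma gamma_tilde_irr_spec f : irreducible f ->
  let mu := Order.min (imult f (fps2_dx f)) (imult f (fps2_dy f)) in
  [/\ (0 <= gamma_tilde_irr f)%E,
     (gamma_tilde_irr f + (mt f)%:Z%:E <= mu + 1%N%:Z%:E)%E &
     (mt f)%:R != 0 :> K -> (gamma_tilde_irr f + (mt f)%:Z%:E = mu + 1%N%:Z%:E)%E].
Proof.
move=> fi mu; have br := irreducible_branch fi; have f0 := branch_neq0 br.
rewrite /gamma_tilde_irr; case: asboolP => [[cX cY]|nc]; last first.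
  have [c cu fE] : exists2 c, c \is a GRing.unit & f = c * fpsX \/ f = c * fpsY.
    have [dX|ndX] := pselect (divides f fpsX).
      by have [c cu ->] := divides_X_unit fi dX; exists c; [|left].
    have [dY|ndY] := pselect (divides f fpsY).
      by have [c cu ->] := divides_Y_unit fi dY; exists c; [|right].
    case: nc; split; rewrite ltey; apply/eqP => /(br_inf br) //.
  (* A unit times x or y has a partial derivative that is a unit, so the conventional value 0 equals
     mu - mt + 1 = 0 - 1 + 1. *)
  have mu0 : mu = 0%E.
    rewrite /mu; case: fE => ->.
      have du : fps2_dx (c * fpsX) \is a GRing.unit.
        rewrite (derM (dx_derivation K)) dxX mulr1 fps2_unitE coef2D mulrC coef2XM.
        by rewrite add0r -fps2_unitE.
      by rewrite (imult_unit _ du) min_l ?imult_ge0.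
    have du : fps2_dy (c * fpsY) \is a GRing.unit.
      rewrite (derM (dy_derivation K)) dyY mulr1 fps2_unitE coef2D mulrC coef2YM.
      by rewrite add0r -fps2_unitE.
    by rewrite (imult_unit _ du) min_r ?imult_ge0.
  by rewrite mu0 (mt_axis cu fE).
rewrite mt_branch // /mu.
move: (imult_dx_ge (f := f)) (imult_dy_ge (f := f)) (branch_jac_mt br) cX cY.
have := mt_branch br f0.
move: (imult_ge0 f (fps2_dx f)) (imult_ge0 f (fps2_dy f)).
case: (imultP f fpsX) => [a _|_]; last by rewrite ltxx.
case: (imultP f fpsY) => [b _|_]; last by rewrite ltxx.
move: (imult f (fps2_dx f)) (imult f (fps2_dy f)) => A B A0 B0 mE /(_ _ erefl) hA /(_ _ erefl) hB hJ _ _.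
have upper := min_arith a b A0 B0; split=> //.
  rewrite le_min; apply/andP; split.
    by clear hB hJ upper B0; move: A A0 hA => [A||] //=; rewrite ?leey // -?EFinD ?lee_fin; lia.
  by clear hA hJ upper A0; move: B B0 hB => [B||] //=; rewrite ?leey // -?EFinD ?lee_fin; lia.
have [J1 J2] := hJ a b erefl erefl.
move=> mK; apply/eqP; rewrite eq_le upper /=.
(* The smaller of a and b is [mt f], the one known to be nonzero in K; it decides between [J1] and
   [J2]. *)
have [ab|ba] := leqP a b.
  have mina : Order.min a%:Z%:E b%:Z%:E = a%:Z%:E :> \bar int.
    by rewrite min_l // lee_fin lez_nat.
  rewrite mina; apply: min_arith_eq => //; apply: J1.
  by move: mE mK; rewrite mina => -[->].
have minb : Order.min a%:Z%:E b%:Z%:E = b%:Z%:E :> \bar int.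
  by rewrite min_r // lee_fin lez_nat ltnW.
rewrite minb minC [X in (_ <= X + _)%E]minC; apply: min_arith_eq => //.
  exact: ltnW.
by apply: J2; move: mE mK; rewrite minb => -[->].
Qed.

(** Induction on [mt], which is additive and positive on nonunits. *)
Lemma factorization_exists f : f <> 0 -> exists s, is_factorization f s.
Proof.
have [m] := ubnP (mt f); elim: m f => // m IH f lt f0.
have [fu|fn] := boolP (f \is a GRing.unit).
  by exists [::]; split=> //; exists f; rewrite // big_nil mulr1.
have [fi|nfi] := pselect (irreducible f).
  exists [:: f]; split=> [q|]; first by rewrite inE => /eqP ->.
  by exists 1; rewrite ?unitr1 // big_seq1 mul1r.
have [g [h [e gn hn]]] : exists g h, [/\ f = g * h, g \isn't a GRing.unit
    & h \isn't a GRing.unit].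
  apply: contrapT => c; apply: nfi; split=> // g h e.
  have [|gn] := boolP (g \is a GRing.unit); first by left.
  have [|hn] := boolP (h \is a GRing.unit); first by right.
  by case: c; exists g, h.
have g0 : g <> 0 by move=> z; apply: f0; rewrite e z mul0r.
have h0 : h <> 0 by move=> z; apply: f0; rewrite e z mulr0.
have mE := mtM g0 h0; rewrite -e in mE.
have gp := mt_gt0 g0 gn; have hp := mt_gt0 h0 hn.
have [s [si [u uu gE]]] := IH g ltac:(lia) g0.
have [t [ti [v vu hE]]] := IH h ltac:(lia) h0.
exists (s ++ t); split=> [q|]; first by rewrite mem_cat => /orP [/si|/ti].
by exists (u * v); rewrite ?unitrM ?uu // big_cat e gE hE /=; ring.
Qed.

Lemma factorsP f : f <> 0 -> is_factorization f (factors f).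
Proof. by move=> /factorization_exists h; apply: (xgetPex [::] h). Qed.

(** * Formulas in terms of the irreducible factors *)

Section WithFactorization.
Variables (f : fps2 K) (s : seq (fps2 K)).
Hypothesis fs : is_factorization f s.

Lemma factor_irreducible (i : 'I_(size s)) : irreducible s`_i.
Proof. by have [h _] := fs; apply/h/mem_nth. Qed.

Lemma factor_branch (i : 'I_(size s)) : branch s`_i.
Proof. exact/irreducible_branch/factor_irreducible. Qed.

Lemma factorization_ord : exists2 u, u \is a GRing.unit &
  f = u * \prod_(i < size s) s`_i.
Proof.
have [_ [u uu e]] := fs; exists u => //.
by rewrite e (big_nth 0) big_mkord.
Qed.

Lemma mt_factors : mt f = (\sum_(i < size s) mt (s`_i)%R)%N.
Proof.
have [u uu ->] := factorization_ord; have u0 := unit_neq0 uu.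
suff [h1 h2] : \prod_(i < size s) s`_i <> 0 /\
    mt (\prod_(i < size s) s`_i) = (\sum_(i < size s) mt (s`_i)%R)%N.
  by rewrite mtM // mt_unit.
elim/big_rec2: _ => [|i n x _ [x0 <-]].
  have one : (1 : fps2 K) \is a GRing.unit := unitr1 _.
  by split; [exact: unit_neq0 | exact: mt_unit].
have i0 := branch_neq0 (factor_branch i).
by split; [apply: fps2_mul_neq0 | rewrite mtM].
Qed.

(** This turns the summand -r of gamma~ into the bound -mt, which does not change with the
    coordinates. *)
Lemma size_factors : (size s <= mt f)%N.
Proof.
rewrite mt_factors -[X in (X <= _)%N]card_ord -sum1_card; apply: leq_sum => i _.
by have [i0 ni _] := factor_irreducible i; apply: mt_gt0.
Qed.

Definition cross (i : 'I_(size s)) := (\sum_(j < size s | j != i) imult s`_i s`_j)%E.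

Definition mu (q : fps2 K) := Order.min (imult q (fps2_dx q)) (imult q (fps2_dy q)).

Lemma imult_dir_factor a b (i : 'I_(size s)) :
  imult s`_i (dir a b f) = (cross i + imult s`_i (dir a b s`_i))%E.
Proof.
have [u uu ->] := factorization_ord.
rewrite (bigD1 i) //= mulrCA imult_dirM; last exact: factor_branch.
congr (_ + _)%E; rewrite imult_unitMr //; apply: imult_prodr; exact: factor_branch.
Qed.

Lemma generic_imult : generic_P1 (fun a b : K =>
  imult f (a *: fps2_dx f + b *: fps2_dy f) =
    (\sum_(i < size s) (cross i + mu s`_i))%E).
Proof.
have [Q QP] := choice (fun i : 'I_(size s) => let: ex_intro2 q h1 h2 :=
   generic_min (fps2_dx s`_i) (fps2_dy s`_i) (factor_branch i) in
   ex_intro (fun q : K * K => q != (0, 0) /\ forall a b, a * q.2 != b * q.1 ->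
     imult s`_i (dir a b s`_i) = mu s`_i) q (conj h1 h2)).
exists [seq Q i | i <- enum 'I_(size s)].
  by apply/mapP => -[i _ e]; have [] := QP i; rewrite -e eqxx.
move=> a b _ hab; have [u uu fE] := factorization_ord.
apply: (etrans (y := (\sum_(i < size s) imult s`_i (dir a b f))%E)).
  change (imult f (dir a b f) = (\sum_(i < size s) imult s`_i (dir a b f))%E).
  move: (dir a b f) => h; rewrite {1}fE.
  exact: (imult_prodl h _ uu factor_branch).
apply: eq_bigr => i _; apply: (etrans (imult_dir_factor a b i)); congr (_ + _)%E.
by apply: (QP i).2; apply: hab; apply: map_f; rewrite mem_enum.
Qed.

(** Two cofinite sets of directions meet: p vanishes at all excluded slopes, so a nonroot b gives an
    admissible direction (1 : b). Hence kappa is well defined. *)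
Lemma generic_uniq (F : K -> K -> \bar int) v w :
  generic_P1 (fun a b => F a b = v) -> generic_P1 (fun a b => F a b = w) -> v = w.
Proof.
move=> [s1 n1 h1] [s2 n2 h2].
pose p : {poly K} := \prod_(q <- s1 ++ s2) (q.1 *: 'X - q.2%:P).
have p0 : p != 0.
  rewrite prodf_seq_neq0; apply/allP => q; rewrite mem_cat => qs; apply/implyP => _.
  apply: contraTN qs => /eqP e.
  have e1 : q.1 = 0.
    by have := congr1 (fun p : {poly K} => p`_1) e; rewrite coefB coefZ coefX coefC coef0 mulr1 subr0.
  have e2 : q.2 = 0.
    have := congr1 (fun p : {poly K} => p`_0) e; rewrite coefB coefZ coefX coefC coef0 mulr0 sub0r.
    by move/eqP; rewrite oppr_eq0 => /eqP.
  have -> : q = (0, 0) by rewrite [q]surjective_pairing e1 e2.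
  by rewrite negb_or n1 n2.
have [b hb] := closed_nonroot p0.
have ok (q : K * K) : q \in s1 ++ s2 -> 1 * q.2 != b * q.1.
  move=> qs; apply: contraNneq hb => e; rewrite horner_prod.
  rewrite prodf_seq_eq0; apply/hasP; exists q => //=.
  by rewrite hornerD hornerN hornerZ hornerX hornerC -[q.2]mul1r e mulrC subrr.
have ne : (1, b) != (0, 0) :> K * K by rewrite xpair_eqE oner_eq0.
rewrite -(h1 1 b ne) => [|q qs]; last by apply: ok; rewrite mem_cat qs.
by apply: h2 => // q qs; apply: ok; rewrite mem_cat qs orbT.
Qed.

Lemma kappa_factors : kappa f = (\sum_(i < size s) (cross i + mu s`_i))%E.
Proof.
rewrite /kappa; have := xgetPex 0%E (ex_intro (fun v => generic_P1 (fun a b : K =>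
  imult f (a *: fps2_dx f + b *: fps2_dy f) = v)) _ generic_imult).
move=> h; exact: generic_uniq h generic_imult.
Qed.

Lemma cross_ge0 i : (0 <= cross i)%E.
Proof. by apply: sume_ge0 => j _; apply: imult_ge0. Qed.

Lemma mu_ge0 q : (0 <= mu q)%E.
Proof. by rewrite le_min; apply/andP; split; apply: imult_ge0. Qed.

Lemma sum_shift (T : 'I_(size s) -> \bar int) (m : 'I_(size s) -> nat) :
  (\sum_i T i + (\sum_i m i)%N%:Z%:E = \sum_i (T i + (m i)%:Z%:E))%E.
Proof.
rewrite big_split /=; congr (_ + _)%E.
by elim/big_rec2: _ => // i x y _ <-; rewrite PoszD EFinD.
Qed.

(** With mt f and the number of factors moved to opposite sides, no subtraction of possibly infinite
    values remains and both sides compare term by term. *)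
Lemma gamma_tilde_factors_spec :
  [/\ ((1 - (mt f)%:Z)%:E <= gamma_tilde_factors s)%E,
     (gamma_tilde_factors s <= kappa f - (mt f)%:Z%:E + 1)%E &
     (forall i : 'I_(size s), (mt s`_i)%:R != 0 :> K) ->
     gamma_tilde_factors s = (kappa f - (mt f)%:Z%:E + 1)%E].
Proof.
pose T (i : 'I_(size s)) := (gamma_tilde_irr s`_i + cross i)%E.
pose S (i : 'I_(size s)) := (cross i + mu s`_i)%E.
have T0 i : (0 <= T i)%E.
  have [h _ _] := gamma_tilde_irr_spec (factor_irreducible i).
  by apply: adde_ge0 => //; apply: cross_ge0.
have S0 i : (0 <= S i)%E by apply: adde_ge0; [exact: cross_ge0 | exact: mu_ge0].
have gE : gamma_tilde_factors s = (\sum_i T i - (size s)%:Z%:E + 1)%E by [].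
have sT : (0 <= \sum_i T i)%E by apply: sume_ge0.
have sS : (0 <= \sum_i S i)%E by apply: sume_ge0.
have sumT : (\sum_i T i + (mt f)%:Z%:E =
    \sum_(i < size s) (cross i + (gamma_tilde_irr s`_i + (mt s`_i)%:Z%:E)))%E.
  rewrite mt_factors sum_shift; apply: eq_bigr => i _.
  by rewrite /T [RHS]addeA (addeC (cross i)).
have sumS : (\sum_i S i + (size s)%:Z%:E =
    \sum_(i < size s) (cross i + (mu s`_i + 1%N%:Z%:E)))%E.
  rewrite -[X in (_ + X%:Z%:E)%E](card_ord (size s)) -sum1_card sum_shift.
  by apply: eq_bigr => i _; rewrite addeA.
rewrite gE kappa_factors; split=> [||hm].
- exact: ereal_shift_ge size_factors.
- apply: ereal_shift_le => //; rewrite sumT sumS; apply: lee_sum => i _.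
  by apply: leeD2l; have [] := gamma_tilde_irr_spec (factor_irreducible i).
apply: ereal_shift_eq => //; rewrite sumT sumS; apply: eq_bigr => i _.
by have [_ _ /(_ (hm i)) ->] := gamma_tilde_irr_spec (factor_irreducible i).
Qed.

End WithFactorization.

Lemma inv_hom Phi : bijective Phi -> exists Psi, cancel Phi Psi /\ cancel Psi Phi.
Proof.
move=> [psi PK KP].
have lin : linear psi.
  by move=> c u v; apply: (can_inj PK); rewrite linearP /= !KP.
have mul : monoid_morphism psi.
  split; first by apply: (can_inj PK); rewrite KP rmorph1.
  by move=> u v; apply: (can_inj PK); rewrite rmorphM /= !KP.
pose Psi : {lrmorphism fps2 K -> fps2 K} :=
  HB.pack psi (GRing.isLinear.Build K (fps2 K) (fps2 K) _ psi lin)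
    (GRing.isMonoidMorphism.Build (fps2 K) (fps2 K) psi mul).
by exists Psi.
Qed.

(** * Invariance under automorphisms *)

Section Transport.
Variables Phi Psi : {lrmorphism fps2 K -> fps2 K}.
Hypotheses (PK : cancel Phi Psi) (KP : cancel Psi Phi).

Let Phi0 g : g <> 0 -> Phi g <> 0.
Proof. by move=> g0 e; apply: g0; rewrite -(PK g) e rmorph0. Qed.

Lemma mt_hom g : g <> 0 -> mt (Phi g) = mt g.
Proof.
move=> g0; have [h1 h2] := mt_inm g0; apply: mtP; first exact: hom_inm.
by move=> /(hom_inm Psi); rewrite PK.
Qed.

Lemma is_factorization_hom g s : is_factorization g s ->
  is_factorization (Phi g) (map Phi s).
Proof.
move=> [si [u uu e]]; split.
  by move=> _ /mapP [q qs ->]; apply: (irreducible_hom PK KP); apply: si.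
exists (Phi u); first by apply: rmorph_unit.
by rewrite e rmorphM rmorph_prod big_map.
Qed.

(** By the chain rule the derivatives of Phi q are combinations of the images of q_x and q_y. The
    reverse inequality comes from the inverse automorphism. *)
Lemma mu_hom_le q : branch (Phi q) -> (mu q <= mu (Phi q))%E.
Proof.
move=> br.
have le D : derivation D -> (mu q <= imult (Phi q) (D (Phi q)))%E.
  move=> hD; rewrite (chain_rule Phi q hD).
  apply: le_trans (br_add br _ _); rewrite !(br_mul br).
  rewrite !(imult_hom _ _ (Bijective PK KP)) /mu.
  move: (imult_ge0 (Phi q) (D (Phi fpsX))) (imult_ge0 (Phi q) (D (Phi fpsY))).
  move: (imult q _) (imult q _) (imult _ (D _)) (imult _ (D _)) => x y z w z0 w0.
  by rewrite le_min !ge_min leeDl // leeDl // orbT.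
by rewrite [X in (_ <= X)%E]/mu le_min; apply/andP; split; apply: le;
  [exact: dx_derivation | exact: dy_derivation].
Qed.

Lemma kappa_hom_le g : g <> 0 -> (kappa g <= kappa (Phi g))%E.
Proof.
move=> g0; have [s hs] := factorization_exists g0.
have hs' := is_factorization_hom hs.
have ss : size (map Phi s) = size s by rewrite size_map.
rewrite (kappa_factors hs) (kappa_factors hs').
pose G n := (\sum_(i < n) (\sum_(j < n | j != i) imult (map Phi s)`_i (map Phi s)`_j
                           + mu (map Phi s)`_i))%E.
rewrite -[X in (_ <= X)%E]/(G _) ss; apply: lee_sum => i _.
have bj := Bijective PK KP.
have nE (j : 'I_(size s)) : (map Phi s)`_j = Phi s`_j by rewrite (nth_map 0).
apply: leeD.
  rewrite /cross le_eqVlt; apply/orP; left; apply/eqP; apply: eq_bigr => j _.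
  by rewrite !nE imult_hom.
rewrite nE; apply/mu_hom_le/irreducible_branch/(irreducible_hom PK KP).
exact: (factor_irreducible hs).
Qed.

End Transport.

Lemma right_equiv_transport f g : f <> 0 -> right_equiv f g ->
  [/\ g <> 0, mt g = mt f, kappa g = kappa f & forall p, m_good p f -> m_good p g].
Proof.
move=> f0 [Phi [bj fE]]; have [Psi [PK KP]] := inv_hom bj.
have g0 : g <> 0 by move=> e; apply: f0; rewrite fE e rmorph0.
have gE : Psi f = g by rewrite fE PK.
have k1 := kappa_hom_le PK KP g0; rewrite -fE in k1.
have k2 := kappa_hom_le KP PK f0; rewrite gE in k2.
split; [exact: g0 | | exact: (le_anti (introT andP (conj k1 k2))) |].
  by have := mt_hom PK g0; rewrite -fE => ->.
move=> p good s hs q qs; have [si _] := hs.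
have q0 : q <> 0 by have [] := si _ qs.
rewrite -(mt_hom PK q0); apply: (good (map Phi s)); last exact: map_f.
by rewrite fE; apply: is_factorization_hom.
Qed.

Lemma gamma_tilde_spec (p : nat) f : has_char K p -> f <> 0 ->
  [/\ ((1 - (mt f)%:Z)%:E <= gamma_tilde f)%E,
     (gamma_tilde f <= kappa f - (mt f)%:Z%:E + 1)%E &
     m_good p f -> gamma_tilde f = (kappa f - (mt f)%:Z%:E + 1)%E].
Proof.
move=> ch f0; have hs := factorsP f0.
have [h1 h2 h3] := gamma_tilde_factors_spec hs; split=> // good; apply: h3 => i.
have qs : (factors f)`_i \in factors f by apply: mem_nth.
have := good _ hs _ qs.
(* For p = 0, divisibility by p means being 0, which in characteristic zero is the same as vanishing
   in K. *)
case: ch => [[-> /pcharf0P ch]|ch]; last by rewrite (dvdn_pcharf ch).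
by rewrite dvd0n -ch.
Qed.

Lemma right_equiv_refl f : right_equiv f f.
Proof. by exists idfun; split=> //; exists idfun. Qed.

Lemma gamma_spec (p : nat) f : has_char K p -> f <> 0 ->
  (exists2 g, right_equiv f g & gamma_tilde g = gamma f) /\
  forall g, right_equiv f g -> (gamma f <= gamma_tilde g)%E.
Proof.
move=> ch f0; rewrite /gamma.
apply: (xgetPex +oo%E (P := fun v => (exists2 g, right_equiv f g & gamma_tilde g = v) /\
  forall g, right_equiv f g -> (v <= gamma_tilde g)%E)).
have lb g : right_equiv f g -> ((1 - (mt f)%:Z)%:E <= gamma_tilde g)%E.
  move=> /(right_equiv_transport f0) [g0 <- _ _].
  by have [] := gamma_tilde_spec ch g0.
(* Finite values are coded by their distance k from the lower bound, so that a least one can be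
   found among natural numbers. If there are none, the minimum is [+oo]. *)
pose val (k : nat) : \bar int := ((1 - (mt f)%:Z) + k%:Z)%:E.
have vals g : right_equiv f g -> gamma_tilde g = +oo%E \/
    exists k, gamma_tilde g = val k.
  move=> /lb; case: (gamma_tilde g) => [z||] //= h; [right|by left].
  move: h; rewrite lee_fin => h; exists (absz (z - (1 - (mt f)%:Z))%R).
  by rewrite /val; congr EFin; lia.
have [[g hg [k e]]|none] := pselect (exists2 g, right_equiv f g &
    exists k, gamma_tilde g = val k); last first.
  have inf g : right_equiv f g -> gamma_tilde g = +oo%E.
    by move=> hg; have [//|hk] := vals g hg; case: none; exists g.
  exists +oo%E; split; last by move=> g /inf ->.
  by exists f; [|apply: inf]; apply: right_equiv_refl.
have : exists k, `[< exists2 g, right_equiv f g & gamma_tilde g = val k >].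
  by exists k; apply/asboolP; exists g.
case/ex_minnP => m /asboolP [g1 hg1 e1] mn; exists (val m); split; first by exists g1.
move=> g2 hg2; have [->|[l el]] := vals g2 hg2; first exact: leey.
have ml : (m <= l)%N by apply/mn/asboolP; exists g2.
by rewrite el lee_fin lerD2l lez_nat.
Qed.

End Factors.

Theorem proposition2p6 (K : closedFieldType) (p : nat) (charKp : has_char K p)
    (f : fps2 K) (f_reduced : reduced f) :
  ((gamma f <= gamma_tilde f)%E /\
   (gamma_tilde f <= kappa f - ((mt f)%:Z)%:E + 1)%E) /\
  (m_good p f ->
   gamma f = gamma_tilde f /\
   gamma_tilde f = (kappa f - ((mt f)%:Z)%:E + 1)%E).
Proof.
have [f0 _] := f_reduced.
have [_ upper sharp] := gamma_tilde_spec charKp f0.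
have [[g fg <-] least] := gamma_spec charKp f0.
split=> [|good]; first by split=> //; apply/least/right_equiv_refl.
(* The coordinates in which [gamma f] is attained are also m-good and have the same right-hand
   side. *)
have [g0 mtE kE gg] := right_equiv_transport f0 fg.
have [_ _ /(_ (gg p good)) sharp_g] := gamma_tilde_spec charKp g0.
rewrite mtE kE in sharp_g.
by split; [exact: etrans sharp_g (esym (sharp good)) | exact: sharp].
Qed.
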